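(* Let $s\ge 2$, $m\ge 1$ and $1\le l\le s$ be integers and put $n=sm+s-l$. Then $e(n,s)=|\mathcal P(s,m,l)|$ holds in each of the following cases: (i) $l=2$ and $s\ge 5$; also $l=2$, $s=4$ and $m$ even; (ii) $m=1$; (iii) $s\ge lm+3l+3$.
   Context: For a family $\mathcal F\subset 2^{[n]}$, a sequence $F_1,\dots,F_s$ of members of $\mathcal F$ is called pairwise disjoint if $F_i\cap F_j=\emptyset$ for all $i\neq j$ (so members can coincide only if they are empty; in particular if $\emptyset\in\mathcal F$ then $\mathcal F$ contains arbitrarily many pairwise disjoint members). The matching number $\nu(\mathcal F)$ is the maximum number of pairwise disjoint members of $\mathcal F$. For $n\ge s\ge 2$, $e(n,s):=\max\{|\mathcal F|:\mathcal F\subset 2^{[n]},\ \nu(\mathcal F)<s\}$. For $n=sm+s-l$ with $0<l\le s$, $\mathcal P(s,m,l):=\{P\subset[n]: |P|+|P\cap[l-1]|\ge m+1\}$, where $[l-1]=\{1,\dots,l-1\}$ (empty if $l=1$). *)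

(* Defs.v *)
From mathcomp Require Import all_boot.
Set Implicit Arguments.
Unset Strict Implicit.
Unset Printing Implicit Defensive.

(* The ground set [n] = {1, ..., n} is represented by 'I_n, the ordinal i
   standing for the integer i.+1. *)

Definition segment (n k : nat) : {set 'I_n} := [set i : 'I_n | i.+1 <= k].

Section Matching.

Variable n : nat.
Implicit Types F : {set {set 'I_n}}.

(* The members A i are indexed, not required to be distinct: the empty set may
   be repeated. *)
Definition has_matching F (k : nat) : bool :=
  [exists A : {ffun 'I_k -> {set 'I_n}},
     [forall i, A i \in F] &&
     [forall i, forall j, (i != j) ==> (A i :&: A j == set0)]].

(* None stands for an infinite matching number.  When set0 \notin F, pairwise
   disjoint members are at most n in number, so that k < n.+1 loses nothing;
   see matching_number_SomeP and matching_number_NoneP. *)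
Definition matching_number F : option nat :=
  if set0 \in F then None
  else Some (\max_(k < n.+1 | has_matching F k) k).

Definition matching_number_lt F (s : nat) : bool :=
  if matching_number F is Some k then k < s else false.

Lemma has_matchingP F k :
  reflect (exists A : 'I_k -> {set 'I_n},
             (forall i, A i \in F) /\
             (forall i j, i <> j -> A i :&: A j = set0))
          (has_matching F k).
Proof.
apply: (iffP existsP) => [[A /andP[/forallP AF /forallP dA]]|[A [AF dA]]].
  exists A; split=> // i j /eqP ij.
  by have /forallP/(_ j)/implyP/(_ ij)/eqP := dA i.
exists (finfun A); apply/andP; split; apply/forallP=> i; first by rewrite ffunE.
by apply/forallP=> j; apply/implyP=> /eqP ij; rewrite !ffunE; apply/eqP/dA.
Qed.

Lemma has_matching0 F : has_matching F 0.
Proof. by apply/has_matchingP; exists (fun=> set0); split=> -[]. Qed.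

Lemma has_matching_bound F k : set0 \notin F -> has_matching F k -> k <= n.
Proof.
move=> F0 /has_matchingP[A [AF dA]].
have Ane i : A i != set0 by apply: contraNneq F0 => <-.
have xA i : exists x, x \in A i by apply/set0Pn.
pose f i := xchoose (xA i).
have fA i : f i \in A i by apply: xchooseP.
have f_inj : injective f.
  move=> i j fij; apply/eqP; apply/negPn/negP => /eqP/dA Aij.
  have : f i \in A i :&: A j by apply/setIP; split; rewrite // fij.
  by rewrite Aij inE.
by have := leq_card f f_inj; rewrite !card_ord.
Qed.

Lemma matching_number_SomeP F k :
  matching_number F = Some k <->
  has_matching F k /\ (forall j, has_matching F j -> j <= k).
Proof.
rewrite /matching_number; case: ifPn => [F0|F0]; split=> //.
- case=> _ /(_ k.+1); rewrite ltnn => H; suff: false by [].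
  apply: H; apply/has_matchingP; exists (fun=> set0); split=> // i j _.
  by rewrite setI0.
- case=> <-; split=> [|j mj]; last first.
    have jn : j < n.+1 by rewrite ltnS (has_matching_bound F0).
    exact: (leq_bigmax_cond (P := fun i : 'I_n.+1 => has_matching F i)
              (F := @nat_of_ord n.+1) (Ordinal jn) mj).
  elim/big_ind: _ => [|x y mx my|//]; first exact: has_matching0.
  by rewrite /maxn; case: ifP.
- case=> mk maxk; congr Some; apply/eqP; rewrite eqn_leq; apply/andP; split.
    by apply/bigmax_leqP=> i /maxk.
  have kn : k < n.+1 by rewrite ltnS (has_matching_bound F0).
  exact: (leq_bigmax_cond (P := fun i : 'I_n.+1 => has_matching F i)
            (F := @nat_of_ord n.+1) (Ordinal kn) mk).
Qed.

Lemma matching_number_NoneP F :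
  matching_number F = None <-> forall k, has_matching F k.
Proof.
rewrite /matching_number; case: ifPn => F0; split=> //.
  move=> _ k; apply/has_matchingP; exists (fun=> set0); split=> // i j _.
  by rewrite setI0.
by move=> /(_ n.+1) /(has_matching_bound F0); rewrite ltnn.
Qed.

End Matching.

Definition e (n s : nat) : nat :=
  \max_(F : {set {set 'I_n}} | matching_number_lt F s) #|F|.

Definition calP (s m l : nat) : {set {set 'I_(s * m + s - l)}} :=
  [set P : {set 'I_(s * m + s - l)} |
     m + 1 <= #|P| + #|P :&: segment _ (l - 1)|].

(* Main.v *)
(** The upper bound is obtained by averaging over the permutations of the ground
    set.  Let [n = s m + s - l] and let [F] have no [s] pairwise disjoint members.
    Cut a random ordering of [n] into [s] blocks of size [m] followed by [s - l]
    single points.  If at least [l] of the blocks are members, each of the others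
    can be given its own point, so one of the enlarged blocks is not a member; the
    cyclic shifts of this assignment give [s - l] missing sets of size [m + 1].
    The excess on the levels up to [m] is thus paid for by missing sets of sizes
    [m + 1] and [m + 2].

    For [m = 1] one such ordering suffices.  For [l = 2] the exact constant
    [C(n - 1, m - 1)] comes from letting the blocks rotate on a circle, as in
    Katona's proof of the Erdos-Ko-Rado theorem.

    For large [s], give a set of size [m + 1 - d] the deficit [d].  If disjoint
    members have total deficit at least [l], the points outside them carry many
    missing sets of size [m + 1], and the averaging bound concludes.  Otherwise one may
    assume that [F] is shifted, and its traces on [{1, ..., l}] are compared with
    those of [P(s, m, l)]: averaging over disjoint [(m - 1)]-sets bounds the traces
    that are absent from [P(s, m, l)], and Frankl's theorem
    [|G| <= nu(G) |shadow G|] bounds the members that avoid [{1, ..., l}]. *)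

Require Import Defs.
From mathcomp Require Import all_boot.
From mathcomp Require Import all_fingroup all_order all_algebra.
From mathcomp Require Import zify ring lra.

Set Implicit Arguments.
Unset Strict Implicit.
Unset Printing Implicit Defensive.

Import Order.TTheory GRing.Theory Num.Theory.

(** * Matchings *)

(** Since [calP s m l] contains every set with more than [m] points, a competitor can only lose on
    the levels [m + 1] and [m + 2]. These losses are the budget for its gains below, and with
    densities as the currency the comparison reduces to inequalities between binomial coefficients.
    For l = 2 a linear ordering is too coarse: [calP] has density m/n on level m, while the ordering
    bounds the density by 1/s plus what missing sets pay for, and m/n < 1/s. On a circle the number
    of member arcs is an integer compared with m, so an excess of one already forces crowded
    windows. In (iii) the threshold l comes from [calP]: the deficit of a member is at most its
    number of points in [l - 1], so disjoint members have total deficit at most l - 1. Reaching l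
    therefore costs a definite amount on level m + 1. A family that stays below l may lose nothing
    there, as [calP] itself shows; its gains are charged instead to the sets of size m that meet [l]
    in a single point of [l - 1] and are not members. *)

Lemma disjoint_of (T : finType) (A B : {set T}) :
  (forall x, x \in A -> x \in B -> False) -> [disjoint A & B].
Proof.
move=> dAB; apply/pred0P => x /=; apply/negbTE/negP => /andP[xA xB].
exact: dAB xA xB.
Qed.

Lemma disjoint_false (T : finType) (A B : {set T}) x :
  [disjoint A & B] -> x \in A -> x \in B -> False.
Proof. by move=> dAB xA; rewrite (disjointFr dAB xA). Qed.

Lemma leq_card_bigcup (T I : finType) (P : pred I) (B : I -> {set T}) :
  #|\bigcup_(i | P i) B i| <= \sum_(i | P i) #|B i|.
Proof.
elim/big_rec2: _ => [|i x U _ le_x]; first by rewrite cards0.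
by apply: leq_trans (leq_card_setU _ _) _; rewrite leq_add2l.
Qed.

(** Matchings built below are indexed by option types and sums; only the number of indices
    matters. *)
Lemma has_matching_fin n (F : {set {set 'I_n}}) k (I : finType)
    (A : I -> {set 'I_n}) :
  k <= #|I| -> (forall i, A i \in F) ->
  (forall i j, i != j -> [disjoint A i & A j]) -> has_matching F k.
Proof.
move=> kI AF dA; apply/has_matchingP.
exists (fun i => A (enum_val (widen_ord kI i))); split=> // i j /eqP ij.
apply/eqP; rewrite setI_eq0; apply: dA; apply: contra ij => /eqP/enum_val_inj.
by move=> /(congr1 val) /= /val_inj ->.
Qed.

Lemma has_matching_le n (F : {set {set 'I_n}}) j k :
  j <= k -> has_matching F k -> has_matching F j.
Proof.
move=> jk /has_matchingP[A [AF dA]].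
apply: (has_matching_fin (A := A)); rewrite ?card_ord // => x y /eqP xy.
by rewrite -setI_eq0 dA.
Qed.

Lemma matching_number_ltE n (F : {set {set 'I_n}}) s :
  matching_number_lt F s = ~~ has_matching F s.
Proof.
rewrite /matching_number_lt; case E: (matching_number F) => [k|].
  have [mk maxk] := (matching_number_SomeP F k).1 E.
  rewrite ltnNge; congr (~~ _); apply/idP/idP; last exact: maxk.
  by move=> sk; apply: has_matching_le mk.
by rewrite ((matching_number_NoneP F).1 E).
Qed.

(** For a permutation [f] this relabels the ground set; for an enumeration [f] of a set [V] it is
    the restriction of [F] to the subsets of [V]. *)
Definition pull N n (f : 'I_N -> 'I_n) (F : {set {set 'I_n}}) :
  {set {set 'I_N}} := [set X : {set 'I_N} | f @: X \in F].

Lemma disjoint_imset (aT rT : finType) (f : aT -> rT) (A B : {set aT}) :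
  injective f -> [disjoint A & B] -> [disjoint f @: A & f @: B].
Proof.
move=> f_inj dAB; apply: disjoint_of => y /imsetP[x xA ->].
by rewrite mem_imset // => /(disjoint_false dAB xA).
Qed.

Lemma has_matching_pull N n (f : 'I_N -> 'I_n) F k :
  injective f -> has_matching (pull f F) k -> has_matching F k.
Proof.
move=> f_inj /has_matchingP[A [AF dA]].
apply: (has_matching_fin (A := fun i => f @: A i)); rewrite ?card_ord //.
  by move=> i; have := AF i; rewrite inE.
by move=> x y /eqP xy; apply: disjoint_imset; rewrite // -setI_eq0 dA.
Qed.

(** * Averaging over permutations *)

Section Averaging.

Variable T : finType.
Implicit Types (F : {set {set T}}) (X S : {set T}) (h : nat).

Definition level F h := #|[set A in F | #|A| == h]|.

(** Each set is listed first and its complement after it; matching the two lists position by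
    position gives the permutation. *)
Lemma ex_perm_imset X S :
  #|X| = #|S| -> exists t : {perm T}, t @: X = S.
Proof.
move=> eqXS.
pose sq (A : {set T}) := enum A ++ enum (~: A).
have sq_mem A x : x \in sq A by rewrite mem_cat !mem_enum inE orbN.
have sq_uniq A : uniq (sq A).
  rewrite cat_uniq !enum_uniq andbT /=; apply/hasPn => x.
  by rewrite !mem_enum inE.
have sq_size A : size (sq A) = #|T| by rewrite size_cat -!cardE cardsC.
pose f x := nth x (sq S) (index x (sq X)).
have idx x A B : index x (sq A) < size (sq B).
  by rewrite sq_size -(sq_size A) index_mem.
have f_inj : injective f.
  move=> x y; rewrite /f (set_nth_default y) // => /eqP.
  by rewrite nth_uniq // => /eqP eqi; rewrite -(nth_index y (sq_mem X x)) eqi nth_index.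
exists (perm f_inj); apply/eqP; rewrite eqEcard card_imset; last exact: perm_inj.
rewrite eqXS leqnn andbT; apply/subsetP => y /imsetP[x xX ->].
rewrite permE /f nth_cat index_cat mem_enum xX -cardE -eqXS cardE index_mem.
rewrite mem_enum xX -mem_enum mem_nth // -cardE -eqXS cardE index_mem.
by rewrite mem_enum.
Qed.

(** The number of permutations carrying [X] to [S] is the same for all [S] of the size of [X], by
    composition with one permutation that carries [X] to [S]. Counting for the family of all sets
    evaluates this number. *)
Lemma sum_perm_mem F X :
  (\sum_(t : {perm T}) (t @: X \in F)) * 'C(#|T|, #|X|) =
  #|T|`! * level F #|X|.
Proof.
pose N S := #|[set t : {perm T} | t @: X == S]|.
have N_eq S : #|S| = #|X| -> N S = N X.
  move=> /esym/ex_perm_imset[u uX].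
  rewrite /N -[RHS](card_imset _ (mulIg u)).
  apply: eq_card => t; rewrite inE; apply/eqP/imsetP => [tX|[v]].
    exists (t * u^-1)%g; last by rewrite mulgKV.
    rewrite inE; apply/eqP.
    have -> : (t * u^-1)%g @: X = u^-1%g @: (t @: X).
      by rewrite -imset_comp; apply: eq_imset => x; rewrite permM.
    rewrite tX -uX -imset_comp -[RHS]imset_id; apply: eq_imset => x /=.
    by rewrite permK.
  rewrite inE => /eqP vX ->.
  have -> : (v * u)%g @: X = u @: (v @: X).
    by rewrite -imset_comp; apply: eq_imset => x; rewrite permM.
  by rewrite vX.
have sumN (G : {set {set T}}) : \sum_(t : {perm T}) (t @: X \in G) = level G #|X| * N X.
  rewrite -big_mkcond /= sum1_card /level -sum_nat_const.
  have -> : #|[pred t : {perm T} | t @: X \in G]| =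
            \sum_(t : {perm T} | t @: X \in G) 1 by rewrite sum1_card.
  rewrite (partition_big (fun t : {perm T} => t @: X)
             (mem [set A in G | #|A| == #|X|])) /=; last first.
    move=> t tG; rewrite inE tG card_imset ?eqxx //; exact: perm_inj.
  apply: eq_bigr => S; rewrite inE => /andP[SG /eqP cS].
  rewrite -(N_eq S cS) /N sum1_card; apply: eq_card => t.
  by rewrite !inE unfold_in; case: eqP => [->|]; rewrite ?andbF ?SG.
have card_all : #|T|`! = 'C(#|T|, #|X|) * N X.
  have := sumN setT; rewrite /level.
  have -> : [set A in [set: {set T}] | #|A| == #|X|] =
            [set A : {set T} | A \subset setT & #|A| == #|X|].
    by apply/setP => A; rewrite !inE subsetT.
  rewrite cards_draws cardsT => <-.
  under eq_bigr do rewrite inE.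
  rewrite sum1_card -[#|T|]cardsT -card_perm; apply: eq_card => t.
  by rewrite unfold_in /=; apply/subsetP => x _; rewrite inE.
rewrite sumN card_all; ring.
Qed.

End Averaging.

Section Mean.

Variable n : nat.
Implicit Types (f g : {perm 'I_n} -> nat) (F : {set {set 'I_n}}).

Definition mean f : rat := ((\sum_t f t)%:R / n`!%:R)%R.

(** For [h > n] this is [0]: both counts vanish, and division by zero gives [0]. *)
Definition dens F h : rat := ((level F h)%:R / 'C(n, h)%:R)%R.

Let fact_neq0 : (n`!%:R != 0 :> rat)%R.
Proof. by rewrite pnatr_eq0 -lt0n fact_gt0. Qed.

Lemma eq_mean f g : f =1 g -> mean f = mean g.
Proof. by move=> fg; rewrite /mean (eq_bigr g). Qed.

Lemma ler_mean f g : (forall t, f t <= g t) -> (mean f <= mean g)%R.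
Proof.
move=> fg; rewrite /mean ler_pM2r ?invr_gt0 ?ltr0n ?fact_gt0 // ler_nat.
exact: leq_sum.
Qed.

Lemma meanD f g : mean (fun t => f t + g t) = (mean f + mean g)%R.
Proof. by rewrite /mean big_split natrD mulrDl. Qed.

Lemma meanZ c f : mean (fun t => c * f t) = (c%:R * mean f)%R.
Proof. by rewrite /mean -big_distrr natrM mulrA. Qed.

Lemma mean_cst c : mean (fun=> c) = c%:R%R.
Proof.
rewrite /mean sum_nat_const.
have -> : #|{perm 'I_n}| = n`!.
  rewrite -[n in n`!]card_ord -[#|'I_n|]cardsT -card_perm; apply: eq_card => t.
  by rewrite !inE unfold_in /=; apply/esym/subsetP => x _; rewrite inE.
by rewrite natrM mulrC mulKf.
Qed.

Lemma mean_sum (I : finType) (f : I -> {perm 'I_n} -> nat) :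
  mean (fun t => \sum_i f i t) = (\sum_i mean (f i))%R.
Proof. by rewrite /mean exchange_big natr_sum mulr_suml. Qed.

Lemma mean_mem F (X : {set 'I_n}) :
  mean (fun t => t @: X \in F) = dens F #|X|.
Proof.
have C0 : ('C(n, #|X|)%:R != 0 :> rat)%R.
  by rewrite pnatr_eq0 -lt0n bin_gt0 -[n in _ <= n]card_ord max_card.
have := sum_perm_mem F X; rewrite card_ord => /(congr1 (fun k => k%:R : rat)%R).
rewrite !natrM /mean /dens => E; apply: (mulIf C0).
by rewrite mulrAC E mulfVK // mulrAC divff // mul1r.
Qed.

Lemma mean_notin F (X : {set 'I_n}) :
  mean (fun t => t @: X \notin F) = (1 - dens F #|X|)%R.
Proof.
rewrite -mean_mem -[1%R](mean_cst 1) -[X in (_ - X)%R]addr0.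
apply/eqP; rewrite eq_sym subr_eq addr0 -meanD; apply/eqP/eq_mean => t.
by case: (_ \in _).
Qed.

End Mean.

(* The [q] cyclic shifts of one injection of [~: R] into ['I_q] use disjoint sets
   of pairs, and each of them contains a bad pair. *)
Lemma cyclic_shift_pairs (I : finType) q (R : {set I})
    (bad : I -> 'I_q -> bool) :
  0 < q -> #|~: R| <= q ->
  (forall phi : I -> 'I_q, {in ~: R &, injective phi} ->
     exists2 i, i \notin R & bad i (phi i)) ->
  q <= \sum_i \sum_j bad i j.
Proof.
move=> q0 Rq badP.
pose rk i := index i (enum (~: R)).
have ltq x : x %% q < q by rewrite ltn_mod.
pose phi (c : 'I_q) i : 'I_q := Ordinal (ltq (rk i + c)).
have rk_lt i : i \notin R -> rk i < q.
  by move=> iR; apply: leq_trans Rq; rewrite cardE index_mem mem_enum inE.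
have phi_inj c : {in ~: R &, injective (phi c)}.
  move=> i j; rewrite !inE => iR jR /(congr1 val) /= /eqP.
  rewrite eqn_modDr !modn_small ?rk_lt // => /eqP eqr.
  rewrite -[i](nth_index i (s := enum (~: R))) ?mem_enum ?inE // -/(rk i) eqr.
  by rewrite nth_index // mem_enum inE.
have /fin_all_exists2[g gR gbad] c := badP _ (phi_inj c).
pose G c := (g c, phi c (g c)).
have G_inj : injective G.
  move=> c d [eg /eqP]; rewrite eg eqn_modDl !modn_small // => /eqP.
  exact: val_inj.
rewrite pair_bigA /=.
have -> : \sum_(p : I * 'I_q) bad p.1 p.2 = #|[set p | bad p.1 p.2]|.
  by rewrite -big_mkcond sum1_card cardsE.
rewrite -{1}(card_ord q) -cardsT -(card_imset _ G_inj).
by apply/subset_leq_card/subsetP => p /imsetP[c _ ->]; rewrite inE gbad.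
Qed.

(** * Consecutive blocks and the missing sets they force *)

Section Blocks.

Variable n : nat.

(** The ordering is kept fixed and the randomness is put into a permutation applied to it: the
    blocks are [blk (i * m) m] for [i < s], and the spare points start at [s * m]. *)
Definition blk a h : {set 'I_n} := [set x : 'I_n | a <= x < a + h].

Lemma mem_blk a h x : (x \in blk a h) = (a <= x < a + h).
Proof. by rewrite inE. Qed.

Lemma card_blk a h : a + h <= n -> #|blk a h| = h.
Proof.
move=> ahn; pose f (i : 'I_h) : 'I_n := widen_ord ahn (rshift a i).
have f_inj : injective f.
  by move=> i j /(congr1 val) /= /addnI /val_inj.
have -> : blk a h = f @: setT.
  apply/setP => x; rewrite inE; apply/idP/imsetP => [xah|[i _ ->]] /=.
    have xh : x - a < h by lia.
    by exists (Ordinal xh) => //; apply: val_inj => /=; lia.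
  by have := ltn_ord i; lia.
by rewrite card_imset // cardsT card_ord.
Qed.

Lemma disjoint_blk a b h k : a + h <= b -> [disjoint blk a h & blk b k].
Proof. by move=> ab; apply: disjoint_of => x; rewrite !inE; lia. Qed.

Lemma blkU_card a h b k :
  a + h <= b -> b + k <= n -> #|blk a h :|: blk b k| = h + k.
Proof.
move=> ab bk; rewrite cardsU !card_blk; [|lia..].
by have /disjoint_setI0-> := disjoint_blk k ab; rewrite cards0 subn0.
Qed.

End Blocks.

Lemma leq_mulS_lt m (i j : nat) : i < j -> i * m + m <= j * m.
Proof. by move=> ij; rewrite -mulSnr leq_mul2r ij orbT. Qed.

Lemma ord_separated m s (i j : 'I_s) :
  i != j -> i * m + m <= j * m \/ j * m + m <= i * m.
Proof.
move=> ij; have: i < j \/ j < i.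
  by apply/orP; rewrite -neq_ltn; apply: contra ij => /eqP/val_inj->.
by case=> /(leq_mulS_lt m); [left|right].
Qed.

Section Core.

Variables (n s m : nat) (F : {set {set 'I_n}}).
Hypothesis F_s : ~~ has_matching F s.

Lemma few_blocks h : h <= m ->
  #|[set i : 'I_s | blk n (i * m) h \in F]| < s.
Proof.
move=> hm; rewrite ltnNge; apply: contra F_s => le_s.
have allF (i : 'I_s) : blk n (i * m) h \in F.
  have : i \in [set i : 'I_s | blk n (i * m) h \in F].
    suff -> : [set i : 'I_s | blk n (i * m) h \in F] = setT by rewrite inE.
    by apply/eqP; rewrite eqEcard subsetT cardsT card_ord.
  by rewrite inE.
apply: (has_matching_fin (A := fun i : 'I_s => blk n (i * m) h)) => //.
  by rewrite card_ord.
move=> i j /(ord_separated m)[] ij; last rewrite disjoint_sym.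
  by apply: disjoint_blk; lia.
by apply: disjoint_blk; lia.
Qed.

(** Blocks in [R] stay at [h] points, and an injection [phi] gives every other block its own group
    of [w] spare points. The resulting [s] sets are disjoint, so some enlarged block is not a
    member. The values [w = 1] and [w = 2] serve for the sets of size [m + 1] and [m + 2]. *)
Lemma many_missing h w q (R := [set i : 'I_s | blk n (i * m) h \in F]) :
  h <= m -> 0 < q -> s - #|R| <= q ->
  q <= \sum_(i < s) \sum_(j < q)
         (blk n (i * m) m :|: blk n (s * m + j * w) w \notin F).
Proof.
move=> hm q0 Rq; apply: (cyclic_shift_pairs (R := R)) => //.
  by have := cardsC R; rewrite card_ord; lia.
move=> phi phi_inj; case: (pickP [pred i | (i \notin R) &&
  (blk n (i * m) m :|: blk n (s * m + phi i * w) w \notin F)]) => [i|noF].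
  by case/andP; exists i.
case/negP: F_s.
apply: (has_matching_fin (A := fun i : 'I_s =>
  if i \in R then blk n (i * m) h
  else blk n (i * m) m :|: blk n (s * m + phi i * w) w)).
- by rewrite card_ord.
- move=> i; case: ifP => [|/negbT iR]; first by rewrite inE.
  by have := noF i; rewrite /= iR => /negbFE.
move=> i j ij; apply: disjoint_of => x xi xj.
have [i_s j_s] := (leq_mulS_lt m (ltn_ord i), leq_mulS_lt m (ltn_ord j)).
have ij' := ord_separated m ij.
move: xi xj; case: ifP => iR; case: ifP => jR; rewrite !inE; try lia.
have : phi i != phi j.
  by apply: contra ij => /eqP/phi_inj-> //; rewrite inE ?iR ?jR.
by move=> /(ord_separated w); lia.
Qed.

End Core.

(** * Windows on a circle *)

Lemma sum_ge2 s (b : nat -> bool) j k :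
  j < k -> k < s -> b j -> b k -> 2 <= \sum_(i < s) b i.
Proof.
move=> jk ks bj bk; have js := ltn_trans jk ks.
rewrite (bigD1 (Ordinal js)) // (bigD1 (Ordinal ks)) /=; last first.
  by rewrite -val_eqE /=; lia.
by rewrite bj bk.
Qed.

Lemma sum_ge3 s (b : nat -> bool) :
  3 <= \sum_(i < s) b i ->
  exists j k l, [/\ j < k, k < l, l < s & [/\ b j, b k & b l]].
Proof.
have -> : \sum_(i < s) b i = size (filter b (iota 0 s)).
  by rewrite size_filter -sumn_count sumnE big_map -[s in iota 0 s]subn0
             -/(index_iota 0 s) big_mkord.
have : sorted ltn (filter b (iota 0 s)).
  by rewrite sorted_filter ?iota_ltn_sorted //; apply: ltn_trans.
have : {subset filter b (iota 0 s) <= [pred i | (i < s) && b i]}.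
  by move=> i; rewrite mem_filter mem_iota add0n /= andbC inE.
case: (filter b (iota 0 s)) => [|j [|k [|l q]]] //= sub /and3P[jk kl _] _.
have /andP[js bj] := sub j (mem_head _ _).
have /andP[ks bk] : k \in [pred i | (i < s) && b i].
  by apply: sub; rewrite !inE eqxx orbT.
have /andP[ls bl] : l \in [pred i | (i < s) && b i].
  by apply: sub; rewrite !inE eqxx !orbT.
by exists j, k, l.
Qed.

Section Periodic.

Variable n : nat.

Lemma periodic_mod (T : Type) (g : nat -> T) :
  (forall x, g (x + n) = g x) -> forall x, g (x %% n) = g x.
Proof.
move=> gP x; rewrite {2}(divn_eq x n) addnC.
by elim: (x %/ n) => [|k IHk]; rewrite ?mul0n ?addn0 // mulSn addnCA addnC gP.
Qed.

Lemma sum_periodic (g : nat -> nat) c :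
  (forall x, g (x + n) = g x) -> \sum_(i < n) g (i + c) = \sum_(i < n) g i.
Proof.
move=> gP; elim: c => [|c <-]; first by apply: eq_bigr => i _; rewrite addn0.
case: n gP => [|k] gP; first by rewrite !big_ord0.
rewrite big_ord_recr [RHS]big_ord_recl /= [RHS]addnC; congr (_ + _).
  by apply: eq_bigr => i _; congr g; rewrite /bump /=; lia.
by rewrite -[g (0 + c)]gP; congr g; lia.
Qed.

End Periodic.

(* [t i] tells whether the arc of length [m] starting at [i] on a circle of
   [n = s m + s - 2] points is a member; [r i] counts the members among the [s]
   consecutive arcs starting at [i].  If [r i >= 3], every window containing the
   middle one of three such arcs contains a second one, hence the [s] windows
   with [r >= 2]. *)
Section Circle.

Variables (s m : nat) (t : nat -> bool).
Let n := s * m + s - 2.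
Let r i := \sum_(j < s) t (i + j * m).

Hypotheses (s_gt3 : 3 < s) (m_gt0 : 0 < m).
Hypotheses (tP : forall x, t (x + n) = t x) (r_lt : forall i, r i < s).

Let a := \sum_(i < n) t i.
Let w1 := \sum_(i < n) (2 <= r i).
Let w2 := \sum_(i < n) (s + 2 <= 2 * r i).

Let n_gt0 : 0 < n. Proof. by rewrite /n; have := muln_gt0 s m; lia. Qed.

Let rP x : r (x + n) = r x.
Proof. by apply: eq_bigr => j _; rewrite addnAC tP. Qed.

Lemma sum_windows : \sum_(i < n) r i = s * a.
Proof.
rewrite exchange_big /= -[s in RHS]card_ord -sum_nat_const.
apply: eq_bigr => j _; rewrite (sum_periodic (g := fun i => nat_of_bool (t i))) //.
by move=> x; rewrite tP.
Qed.

Lemma crowded_windows i : 3 <= r i -> s <= w1.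
Proof.
move=> /(@sum_ge3 s (fun j => t (i + j * m)))[j1 [j2 [j3 [j12 j23 j3s [t1 t2 t3]]]]].
have ltn0 x : x %% n < n by rewrite ltn_mod.
(* [f c] is the window in which the middle arc has position [c]; the added [n] keeps the truncated
   subtraction exact. *)
pose f (c : 'I_s) : 'I_n := Ordinal (ltn0 (i + j2 * m + n - c * m)).
have cm (c : 'I_s) : c * m + m <= s * m by apply: leq_mulS_lt.
have f_inj : injective f.
  have le_inj (c d : 'I_s) : c <= d -> f c = f d -> c = d.
    move=> cd /(congr1 val) /= /eqP; rewrite eqn_mod_dvd; last first.
      have : c * m <= d * m by rewrite leq_mul2r cd orbT.
      lia.
    have -> : i + j2 * m + n - c * m - (i + j2 * m + n - d * m) = (d - c) * m.
      rewrite mulnBl; have := cm c; have := cm d; rewrite /n; lia.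
    case: (posnP (d - c)) => [dc0 _|dc_gt0 /dvdn_leq]; first by apply: val_inj => /=; lia.
    rewrite muln_gt0 dc_gt0 m_gt0 => /(_ isT); have := cm d; rewrite mulnBl /n.
    lia.
  move=> c d; case: (leqP c d) => [/le_inj//|/ltnW/le_inj h /esym/h//].
have f2 c : 2 <= r (f c).
  rewrite /f /= (periodic_mod rP).
  have cms := cm c; pose u := i + j2 * m + n - c * m.
  have tc : t (u + c * m).
    have -> : u + c * m = i + j2 * m + n by rewrite /u /n; lia.
    by rewrite tP.
  (* If [c >= j2 - j1], the first of the three arcs lies in the window as well; otherwise the third
     does, because [j3 - j1 < s]. *)
  have [le_c|lt_c] := leqP (j2 - j1) c.
    apply: (sum_ge2 (b := fun j => t (u + j * m)) (j := c - (j2 - j1)) (k := c)) => //.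
      by have := ltn_ord c; lia.
    have -> : u + (c - (j2 - j1)) * m = i + j1 * m + n.
      have : (j2 - j1) * m <= c * m by rewrite leq_mul2r le_c orbT.
      have : j1 * m <= j2 * m by rewrite leq_mul2r (ltnW j12) orbT.
      by rewrite /u !mulnBl /n; lia.
    by rewrite tP.
  apply: (sum_ge2 (b := fun j => t (u + j * m)) (j := c) (k := c + (j3 - j2))) => //.
  - by lia.
  - by lia.
  have -> : u + (c + (j3 - j2)) * m = i + j3 * m + n.
    have : j2 * m <= j3 * m by rewrite leq_mul2r (ltnW j23) orbT.
    by rewrite /u mulnDl mulnBl /n; lia.
  by rewrite tP.
have -> : w1 = #|[set x : 'I_n | 2 <= r x]|.
  by rewrite /w1 -big_mkcond sum1_card cardsE.
rewrite -{1}(card_ord s) -cardsT -(card_imset _ f_inj).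
by apply/subset_leq_card/subsetP => x /imsetP[c _ ->]; rewrite inE f2.
Qed.

(** Let [a > m]. If some [r i >= 3], the bound 2r <= 2 + (s - 1)[r >= 2] + (s - 3)[2r >= s + 2],
    tight at r = (s + 1)/2 and r = s - 1, is summed over all windows. The surplus 2s(s - 2) of 2sn
    over 2s^2 m is absorbed by [w1 >= s], which turns the coefficient s(s - 1) into s^2 + s - 4.
    Otherwise r <= 1 + [r >= 2], and s a >= s(m + 1) = n + 2 gives [w1 >= 2], which absorbs the same
    surplus. *)
Lemma circle_bound :
  2 * s ^ 2 * a <= 2 * s ^ 2 * m + (s ^ 2 + s - 4) * w1 + s * (s - 3) * w2.
Proof.
have [am|ma] := leqP a m; first by apply: leq_trans (leq_mul (leqnn _) am) _; lia.
have ra := sum_windows.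
have nE : n = s * m + (s - 2) by rewrite /n; lia.
have cst k : \sum_(i < n) k = k * n by rewrite sum_nat_const card_ord mulnC.
case: (pickP [pred i : 'I_n | 3 <= r i]) => [i /crowded_windows sw|r_le2].
  have le_r (j : 'I_n) : 2 * s * r j <=
      2 * s + s * (s - 1) * (2 <= r j) + s * (s - 3) * (s + 2 <= 2 * r j).
    have : 2 * r j <= 2 + (s - 1) * (2 <= r j) + (s - 3) * (s + 2 <= 2 * r j).
      by have := r_lt j; case: (ltnP 1 (r j)) => r1; case: leqP => r2 rs; lia.
    have -> : 2 * s * r j = s * (2 * r j) by ring.
    move=> le2; apply: (@leq_trans (s * (2 + (s - 1) * (2 <= r j) +
                                        (s - 3) * (s + 2 <= 2 * r j)))).
      by rewrite leq_mul2l le2 orbT.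
    by rewrite !mulnDr !mulnA (mulnC s 2).
  have : 2 * s * (s * a) <= 2 * s * n + s * (s - 1) * w1 + s * (s - 3) * w2.
    rewrite -ra -cst !big_distrr -!big_split /=.
    exact: leq_sum.
  have -> : 2 * s * n = 2 * s ^ 2 * m + 2 * (s - 2) * s by rewrite nE; ring.
  have -> : s ^ 2 + s - 4 = s * (s - 1) + 2 * (s - 2).
    rewrite mulnBr muln1 -mulnn; have : s <= s * s by rewrite leq_pmulr //; lia.
    by move: (s * s) => z; lia.
  have : 2 * (s - 2) * s <= 2 * (s - 2) * w1 by rewrite leq_mul.
  have -> : 2 * s * (s * a) = 2 * s ^ 2 * a by ring.
  rewrite mulnDl; lia.
have le_r (j : 'I_n) : r j <= 1 + (2 <= r j).
  by have := r_le2 j; rewrite /=; case: (ltnP 1 (r j)); lia.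
have : s * a <= n + w1.
  rewrite -ra -[n in X in _ <= X]mul1n -cst -big_split /=.
  exact: leq_sum.
move=> sa; have w1_ge2 : 2 <= w1.
  have : s * m.+1 <= s * a by rewrite leq_mul.
  by rewrite mulnS; lia.
have : (s - 2) * 2 <= (s - 2) * w1 by rewrite leq_mul.
have : s * 2 * (s * a) <= s * 2 * (s * m + (s - 2) + w1).
  by rewrite leq_mul2l; apply/orP; right; lia.
have -> : s * 2 * (s * a) = 2 * s ^ 2 * a by ring.
move=> le1 le2; apply: leq_trans le1 _.
have -> : s * 2 * (s * m + (s - 2) + w1) =
  2 * s ^ 2 * m + s * ((s - 2) * 2 + 2 * w1) by ring.
rewrite -addnA leq_add2l; apply: (@leq_trans (s * (s * w1))).
  rewrite leq_mul2l; apply/orP; right.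
  have -> : s * w1 = (s - 2) * w1 + 2 * w1 by rewrite -mulnDl subnK //; lia.
  by rewrite leq_add2r.
rewrite mulnA mulnn; apply: leq_trans (leq_addr _ _).
by rewrite leq_mul2r; apply/orP; right; lia.
Qed.

End Circle.

Lemma sum_even_odd N (f : nat -> nat) :
  \sum_(i < N.*2) f i = \sum_(x < N) f x.*2 + \sum_(x < N) f x.*2.+1.
Proof.
elim: N => [|N IHN]; first by rewrite !big_ord0.
by rewrite doubleS !big_ord_recr /= IHN -addnA addnACA.
Qed.

(* For [s = 4] and [m = 2k] the two parity classes of the circle, of odd size
   [4k + 1], are treated separately: the defect [4 a_e - (4k + 1)] of a class
   cannot be [1], so that an excess of one member gives three crowded windows
   instead of two. *)
Lemma circle_bound4 (k : nat) (t : nat -> bool) (m := k.*2)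
    (n := 4 * m + 4 - 2) (r := fun i => \sum_(j < 4) t (i + j * m)) :
  (forall x, t (x + n) = t x) -> (forall i, r i < 4) ->
  3 * \sum_(i < n) t i <=
  3 * m + \sum_(i < n) (2 <= r i) + \sum_(i < n) (4 + 2 <= 2 * r i).
Proof.
move=> tP r_lt; have nE : n = ((4 * k).+1).*2 by rewrite /n /m; lia.
have class_bound (d : nat -> nat) :
    (forall x y, d (x + y) = d x + y.*2) ->
    4 * \sum_(x < (4 * k).+1) t (d x) <=
    (4 * k).+1 + \sum_(x < (4 * k).+1)
       ((2 <= r (d x)) + (4 + 2 <= 2 * r (d x))).
  move=> dD; pose g x := nat_of_bool (t (d x)).
  have gP x : g (x + (4 * k).+1) = g x.
    rewrite /g -[t (d x)]tP; congr (nat_of_bool (t _)).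
    by rewrite nE dD; lia.
  have sum_r : \sum_(x < (4 * k).+1) r (d x) = 4 * \sum_(x < (4 * k).+1) g x.
    transitivity (\sum_(j < 4) \sum_(x < (4 * k).+1) g x); last first.
      by rewrite sum_nat_const card_ord.
    rewrite exchange_big /=; apply: eq_bigr => j _; apply: etrans (sum_periodic (j * k) gP).
    by apply: eq_bigr => x _; congr (nat_of_bool (t _)); rewrite /m dD; lia.
  rewrite -/g in sum_r *; rewrite -[\sum_(x < _) t _]/(\sum_(x < (4 * k).+1) g x) -sum_r.
  apply: (@leq_trans (\sum_(x < (4 * k).+1)
    (1 + ((2 <= r (d x)) + (4 + 2 <= 2 * r (d x)))))); last first.
    by rewrite big_split /= sum_nat_const card_ord muln1.
  apply: leq_sum => x _.
  by have := r_lt (d x); do 2!case: leqP; lia.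
have c0 := class_bound double doubleD.
have c1 : _ := class_bound (fun x => x.*2.+1) (fun x y => congr1 S (doubleD x y)).
rewrite !big_split /= in c0 c1.
rewrite nE (sum_even_odd _ (fun i => nat_of_bool (t i))).
rewrite (sum_even_odd _ (fun i => nat_of_bool (2 <= r i))).
rewrite (sum_even_odd _ (fun i => nat_of_bool (4 + 2 <= 2 * r i))).
have -> : m = 2 * k by rewrite /m mul2n.
(* In each class, a members and w crowded windows, those with r >= 3 counted twice, satisfy 4a <= 4k
   + 1 + w. If a = k + d with d >= 1, then w >= 4d - 1 >= 3d; so always 3a <= 3k + w, and the two
   classes add up. *)
move: c0 c1; do 6!move: (\sum_(_ < _) _) => ?; lia.
Qed.

(** * Levels of a family *)

Section Levels.

Variable n : nat.
Implicit Types F P : {set {set 'I_n}}.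

Definition low F k := \sum_(h < k.+1) level F h.

Lemma lowE F k : low F k = #|[set A in F | #|A| <= k]|.
Proof.
transitivity (\sum_(A in [set A in F | #|A| <= k]) 1); last exact: sum1_card.
rewrite (partition_big (fun A : {set 'I_n} => inord #|A| : 'I_k.+1) xpredT) //=.
apply: eq_bigr => h _; rewrite sum1_card; apply: eq_card => A.
rewrite [in RHS]unfold_in !inE.
have [Ak|kA] := leqP #|A| k; last first.
  rewrite andbF /=; apply/negbTE; rewrite negb_and; apply/orP; right.
  by rewrite neq_ltn orbC (leq_trans (ltn_ord h) kA).
by rewrite andbT -val_eqE /= inordK.
Qed.

Lemma low_rec F k : low F k.+1 = low F k + level F k.+1.
Proof. by rewrite /low big_ord_recr. Qed.

(** Also applied with [k = m + 2], beyond the size from which [P] is full, so that the sets missing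
    on the levels [m + 1] and [m + 2] count against the gains below. *)
Lemma card_le_low F P k :
  (forall A : {set 'I_n}, k < #|A| -> A \in P) -> low F k <= low P k ->
  #|F| <= #|P|.
Proof.
move=> Pbig; rewrite !lowE => le_low.
pose S := [set A : {set 'I_n} | #|A| <= k].
have E (G : {set {set 'I_n}}) : #|[set A in G | #|A| <= k]| = #|G :&: S|.
  by apply: eq_card => A; rewrite !inE.
rewrite !E in le_low; rewrite -(cardsID S F) -(cardsID S P) leq_add //.
apply/subset_leq_card/subsetP => A; rewrite !inE -ltnNge => /andP[kA _].
by rewrite kA Pbig.
Qed.

Lemma level_le F h : level F h <= 'C(n, h).
Proof.
rewrite -[n in 'C(n, _)]card_ord -cardsT -cards_draws.
by apply/subset_leq_card/subsetP => A; rewrite !inE subsetT => /andP[].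
Qed.

Lemma level_full F h :
  (forall A : {set 'I_n}, #|A| = h -> A \in F) -> level F h = 'C(n, h).
Proof.
move=> Fh; rewrite -[n in 'C(n, _)]card_ord -cardsT -cards_draws.
by apply: eq_card => A; rewrite !inE subsetT; case: eqP => [/Fh->|]; rewrite ?andbF.
Qed.

Lemma level_set0 F : ~~ (set0 \in F) -> level F 0 = 0.
Proof.
move=> F0; apply/eqP; rewrite cards_eq0 -subset0; apply/subsetP => A.
by rewrite !inE cards_eq0 => /andP[AF /eqP A0]; rewrite -A0 AF in F0.
Qed.

Lemma levelE F h : h <= n -> ((level F h)%:R = dens F h * 'C(n, h)%:R :> rat)%R.
Proof. by move=> hn; rewrite divfK // pnatr_eq0 -lt0n bin_gt0. Qed.

Lemma dens_ge0 F h : (0 <= dens F h)%R.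
Proof. by rewrite divr_ge0 ?ler0n. Qed.

Lemma dens_le1 F h : (dens F h <= 1)%R.
Proof.
rewrite /dens; have [nh|hn] := ltnP n h; first by rewrite bin_small // invr0 mulr0.
by rewrite ler_pdivrMr ?ltr0n ?bin_gt0 // mul1r ler_nat level_le.
Qed.

End Levels.

(** The induction closes because m + (n + 1 - 2(m + 1)) <= n - m and (n - m) C(n, m) = (m + 1) C(n,
    m + 1). *)
Lemma sum_bin_lt n m : 2 * m <= n.+1 ->
  (n.+1 - 2 * m) * \sum_(h < m) 'C(n, h) <= m * 'C(n, m).
Proof.
elim: m => [|m IHm] mn; first by rewrite big_ord0 muln0.
have {}IHm := IHm ltac:(lia).
rewrite big_ord_recr /= mulnDr mul_bin_left.
apply: (@leq_trans (m * 'C(n, m) + (n.+1 - 2 * m.+1) * 'C(n, m))).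
  rewrite leq_add2r; apply: leq_trans IHm.
  by rewrite leq_mul2r; apply/orP; right; lia.
by rewrite -mulnDl leq_mul2r; apply/orP; right; lia.
Qed.

(** * The averaging inequality for one level *)

Lemma has_matching_perm n (F : {set {set 'I_n}}) (t : {perm 'I_n}) s :
  ~~ has_matching F s -> ~~ has_matching (pull t F) s.
Proof. by apply: contra => /has_matching_pull; apply; apply: perm_inj. Qed.

Section Config.

Variables (n s m l : nat) (F : {set {set 'I_n}}).
Hypotheses (nE : n = s * m + s - l) (F_s : ~~ has_matching F s).
Hypothesis ls : 0 < l < s.

Definition miss (i w j : nat) (f : 'I_n -> 'I_n) : bool :=
  f @: (blk n (i * m) m :|: blk n (s * m + j * w) w) \notin F.

Lemma card_config (i : 'I_s) w q (j : 'I_q) : q * w <= s - l ->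
  #|blk n (i * m) m :|: blk n (s * m + j * w) w| = m + w.
Proof.
move=> qw; have jq := leq_mulS_lt w (ltn_ord j).
have im := leq_mulS_lt m (ltn_ord i); apply: blkU_card; lia.
Qed.

Lemma config_missing (f : 'I_n -> 'I_n) h w q :
  injective f -> h <= m -> 0 < q ->
  s - \sum_(i < s) (f @: blk n (i * m) h \in F) <= q ->
  q <= \sum_(i < s) \sum_(j < q) miss i w j f.
Proof.
set r := \sum_(i < s) _ => f_inj hm q0 rq.
have F_s' : ~~ has_matching (pull f F) s.
  by apply: contra F_s => /has_matching_pull; apply.
have rE : r = #|[set i : 'I_s | blk n (i * m) h \in pull f F]|.
  by rewrite /r -big_mkcond sum1_card; apply: eq_card => i; rewrite unfold_in /= !inE.
have := many_missing F_s' w hm q0; rewrite -rE => /(_ rq).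
congr (_ <= _); apply: eq_bigr => i _; apply: eq_bigr => j _.
by rewrite /miss inE.
Qed.

Lemma config_few (f : 'I_n -> 'I_n) h :
  injective f -> h <= m -> \sum_(i < s) (f @: blk n (i * m) h \in F) < s.
Proof.
move=> f_inj hm; have F_s' : ~~ has_matching (pull f F) s.
  by apply: contra F_s => /has_matching_pull; apply.
have := few_blocks F_s' hm; congr (_ < _).
by rewrite -big_mkcond sum1_card; apply: eq_card => i; rewrite !inE unfold_in.
Qed.

(** The permutations [g c] allow several fixed rearrangements of one random ordering: only the
    identity in [level_excess], all [n] rotations in [level_circle]. *)
Lemma mean_config (I : finType) (g : I -> {perm 'I_n}) w q : q * w <= s - l ->
  mean (fun t => \sum_c \sum_(i < s) \sum_(j < q) miss i w j (t \o g c)) =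
  ((#|I| * s * q)%:R * (1 - dens F (m + w)))%R.
Proof.
move=> qw; rewrite mean_sum.
under eq_bigr => c _.
  rewrite mean_sum; under eq_bigr => i _.
    rewrite mean_sum; under eq_bigr => j _.
      under eq_mean do rewrite /miss imset_comp.
      rewrite mean_notin card_imset; last exact: perm_inj.
      rewrite card_config //; over.
    rewrite sumr_const card_ord; over.
  rewrite sumr_const card_ord; over.
rewrite sumr_const -!mulrnA mulr_natl; congr (_ *+ _)%R.
rewrite -[#|xpredT|]/(#|I|).
by rewrite mulnA mulnC [q * s]mulnC mulnA.
Qed.

(* If [2 r >= s + l] blocks are members, each of the others can even be given
   a pair of points, so that sets of size [m + 2] are missing as well. *)
Lemma level_excess h : 1 < s - l -> h <= m ->
  ((2 * s)%:R * dens F h <=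
   (2 * (l - 1))%:R + ((s - l + 1) * s)%:R * (1 - dens F m.+1)
   + ((s - l - 1) * s)%:R * (1 - dens F m.+2))%R.
Proof.
move=> sl hm; pose q := (s - l)./2.
have q_gt0 : 0 < q by rewrite /q; lia.
have qw : q * 2 <= s - l by rewrite /q; lia.
pose g (c : unit) : {perm 'I_n} := 1%g.
pose r (t : {perm 'I_n}) := \sum_(i < s) ((t \o g tt) @: blk n (i * m) h \in F).
pose M w p (t : {perm 'I_n}) :=
  \sum_(c : unit) \sum_(i < s) \sum_(j < p) miss i w j (t \o g c).
have tg_inj (t : {perm 'I_n}) : injective (t \o g tt).
  by apply: inj_comp; apply: perm_inj.
have ME w p (t : {perm 'I_n}) :
    M w p t = \sum_(i < s) \sum_(j < p) miss i w j (t \o g tt).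
  by rewrite /M (bigD1 tt) // big_pred0 => [|[]] //; apply: addn0.
have M1 (t : {perm 'I_n}) : l <= r t -> s - l <= M 1 (s - l) t.
  move=> lr; rewrite ME; apply: (@config_missing _ h) => //; first lia.
  by move: lr; rewrite /r; move: (\sum_(i < s) _) => k; rewrite ?/q; lia.
have M2 (t : {perm 'I_n}) : s + l <= 2 * r t -> q <= M 2 q t.
  move=> lr; rewrite ME; apply: (@config_missing _ h) => //.
  by move: lr; rewrite /r; move: (\sum_(i < s) _) => k; rewrite /q; lia.
have r_lt t : r t < s by apply: config_few.
(* Pointwise 2r <= 2(l - 1) + (s - l + 1)[r >= l] + (s - l - 1)[2r >= s + l]; the coefficients are
   dictated by 2r = s + l - 1 and r = s - 1. The indicators are bounded by [M 1 (s - l) t] over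
   [s - l] and [M 2 q t] over [q], and the denominators are cleared. *)
have bound t : (2 * (s - l) * q) * r t <= 2 * (s - l) * q * (l - 1) +
    ((s - l + 1) * q * M 1 (s - l) t + (s - l - 1) * (s - l) * M 2 q t).
  move: (r_lt t) (M1 t) (M2 t).
  move: (r t) (M 1 (s - l) t) (M 2 q t) => k x y ks M1k M2k.
  have [lt_k|le_k] := ltnP k l.
    apply: leq_trans (leq_addr _ _); rewrite leq_mul2l; apply/orP; right; lia.
  have {}M1k : (s - l + 1) * q * (s - l) <= (s - l + 1) * q * x.
    by rewrite leq_mul2l M1k ?orbT.
  have [lt_k2|le_k2] := ltnP (2 * k) (s + l).
    have : (s - l) * q * (2 * k) <= (s - l) * q * (2 * (l - 1) + (s - l + 1)).
      by rewrite leq_mul2l; apply/orP; right; lia.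
    by move: (s - l) (l - 1) M1k => d l1; lia.
  have {}M2k : (s - l - 1) * (s - l) * q <= (s - l - 1) * (s - l) * y.
    by rewrite leq_mul2l M2k ?orbT.
  have : (s - l) * q * (2 * k) <=
      (s - l) * q * (2 * (l - 1) + (s - l + 1) + (s - l - 1)).
    by rewrite leq_mul2l; apply/orP; right; lia.
  by move: (s - l - 1) (s - l) (l - 1) M1k M2k => d1 d l1; lia.
have := ler_mean bound; rewrite meanD mean_cst meanD !meanZ.
rewrite !mean_config //; last by rewrite muln1.
rewrite mean_sum.
under eq_bigr => i _.
  under eq_mean do rewrite imset_comp.
  rewrite mean_mem card_imset; last exact: perm_inj.
  rewrite card_blk; last by have := leq_mulS_lt m (ltn_ord i); lia.
  over.
rewrite sumr_const card_ord card_unit mul1n (addn1 m) (addn2 m) -[(_ *+ s)%R]mulr_natl !natrM.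
set x := dens F h; set y := dens F m.+1; set z := dens F m.+2.
have pos k : 0 < k -> (0 < k%:R :> rat)%R by rewrite ltr0n.
have sl0 : (0 < (s - l)%:R :> rat)%R by apply: pos; lia.
have q0 := pos q q_gt0.
by move=> le; rewrite -(ler_pM2l (mulr_gt0 sl0 q0)); lra.
Qed.

End Config.

(** * The case l = 2 *)

Section Rotation.

Variables (n : nat) (n_gt0 : 0 < n).

Let lt_mod x : x %% n < n. Proof. by rewrite ltn_mod. Qed.

Definition rot_fun k (x : 'I_n) : 'I_n := Ordinal (lt_mod (x + k)).

Lemma rot_fun_inj k : injective (rot_fun k).
Proof.
move=> x y /(congr1 val) /= /eqP; rewrite eqn_modDr !modn_small // => /eqP.
exact: val_inj.
Qed.

Definition rotp k : {perm 'I_n} := perm (@rot_fun_inj k).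

Lemma rotp_period k (X : {set 'I_n}) : rotp (k + n) @: X = rotp k @: X.
Proof.
by apply: eq_imset => x; rewrite !permE; apply: val_inj; rewrite /= addnA modnDr.
Qed.

Lemma rotp_blk k a h : a + h <= n ->
  rotp k @: blk n a h = rotp (k + a) @: blk n 0 h.
Proof.
move=> ahn; apply/setP => y; apply/imsetP/imsetP => -[x]; rewrite inE => xh ->.
  have xan : x - a < n by have := ltn_ord x; lia.
  exists (Ordinal xan); first by rewrite inE /=; lia.
  rewrite !permE; apply: val_inj; congr (_ %% _) => /=; lia.
have xan : x + a < n by lia.
exists (Ordinal xan); first by rewrite inE /=; lia.
by rewrite !permE; apply: val_inj; congr (_ %% _) => /=; lia.
Qed.

End Rotation.

Lemma imset_perm_comp n (t u : {perm 'I_n}) (X : {set 'I_n}) :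
  (t \o u) @: X = t @: (u @: X).
Proof. exact: imset_comp. Qed.

Lemma mul_bin_pred n m : 0 < m -> n * 'C(n.-1, m.-1) = m * 'C(n, m).
Proof. by case: m => // m _; rewrite mul_bin_diag. Qed.

Section Two.

Variables (n s m : nat) (F : {set {set 'I_n}}).
Hypotheses (nE : n = s * m + s - 2) (F_s : ~~ has_matching F s).
Hypotheses (s_gt3 : 3 < s) (m_gt0 : 0 < m).

Let n_gt0 : 0 < n. Proof. by rewrite nE; have := muln_gt0 s m; lia. Qed.

Let mn : m.+2 <= n.
Proof. by have := leq_mul s_gt3 (leqnn m); rewrite nE; lia. Qed.

(** Each window of the circle is a linear ordering once cut at its start, so [config_missing]
    applies: it gives [s - 2] missing sets of size [m + 1] when r >= 2, and [q] missing sets of size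
    [m + 2] when 2r >= s + 2. The constants are parameters because [s = 4] has a circle inequality
    of its own. *)
Lemma level_circle c0 c1 c2 :
  (forall t : nat -> bool, (forall x, t (x + n) = t x) ->
     (forall i, \sum_(j < s) t (i + j * m) < s) ->
     c0 * \sum_(i < n) t i <= c0 * m
       + c1 * \sum_(i < n) (2 <= \sum_(j < s) t (i + j * m))
       + c2 * \sum_(i < n) (s + 2 <= 2 * \sum_(j < s) t (i + j * m))) ->
  (c0%:R * n%:R * dens F m <= c0%:R * m%:R
     + n%:R * (c1 * s)%:R * (1 - dens F m.+1)
     + n%:R * (c2 * s)%:R * (1 - dens F m.+2))%R.
Proof.
move=> circle; pose q := (s - 2)./2.
have q_gt0 : 0 < q by rewrite /q; lia.
have qw : q * 2 <= s - 2 by rewrite /q; lia.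
have ls : 0 < 2 < s by lia.
pose g (c : 'I_n) : {perm 'I_n} := rotp n_gt0 c.
pose M w p (t : {perm 'I_n}) :=
  \sum_(c < n) \sum_(i < s) \sum_(j < p) miss s m F i w j (t \o g c).
pose mem (t : {perm 'I_n}) k := (t \o rotp n_gt0 k) @: blk n 0 m \in F.
have mem_blk' (t : {perm 'I_n}) k j : j < s ->
    mem t (k + j * m) = ((t \o rotp n_gt0 k) @: blk n (j * m) m \in F).
  move=> /(leq_mulS_lt m) js; rewrite /mem !imset_perm_comp.
  have jn : j * m + m <= n by lia.
  by rewrite -(rotp_blk n_gt0 k jn).
have memP t x : mem t (x + n) = mem t x by rewrite /mem !imset_perm_comp rotp_period.
have sum_mem t k : \sum_(j < s) mem t (k + j * m) =
    \sum_(j < s) ((t \o rotp n_gt0 k) @: blk n (j * m) m \in F).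
  by apply: eq_bigr => j _; rewrite mem_blk'.
have tg_inj (t : {perm 'I_n}) k : injective (t \o rotp n_gt0 k).
  by apply: inj_comp; apply: perm_inj.
have mem_lt t k : \sum_(j < s) mem t (k + j * m) < s.
  rewrite sum_mem; exact: (config_few F_s).
have M1 t : (s - 2) * \sum_(c < n) (2 <= \sum_(j < s) mem t (c + j * m)) <=
    M 1 (s - 2) t.
  rewrite big_distrr; apply: leq_sum => c _ /=.
  have [le2|//] := leqP 2; last by rewrite muln0.
  rewrite muln1; apply: (config_missing F_s _ (tg_inj t c) (leqnn m)); first by lia.
  by rewrite -sum_mem leq_sub2l // ltnW.
have M2 t : q * \sum_(c < n) (s + 2 <= 2 * \sum_(j < s) mem t (c + j * m)) <=
    M 2 q t.
  rewrite big_distrr; apply: leq_sum => c _ /=.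
  have [le2|//] := leqP (s + 2); last by rewrite muln0.
  rewrite muln1; apply: (config_missing F_s _ (tg_inj t c) (leqnn m)) => //.
  by rewrite -sum_mem; move: (\sum_(j < s) _) le2 => k; rewrite /q; lia.
have bound t : (c0 * (s - 2) * q) * \sum_(i < n) mem t i <=
    c0 * (s - 2) * q * m +
    (c1 * q * M 1 (s - 2) t + c2 * (s - 2) * M 2 q t).
  move: (M1 t) (M2 t) (circle _ (memP t) (mem_lt t)).
  move: (M _ _ _) (M _ _ _) (\sum_(i < n) mem t i) => x y a.
  move: (\sum_(i < n) _) (\sum_(i < n) _) => w1 w2.
  move=> /(leq_mul (leqnn (c1 * q))) M1k /(leq_mul (leqnn (c2 * (s - 2)))) M2k.
  move=> /(leq_mul (leqnn ((s - 2) * q))).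
  by move: (s - 2) M1k M2k => d; lia.
have := ler_mean bound; rewrite meanD mean_cst meanD !meanZ.
rewrite !(mean_config nE F_s ls) //; last by rewrite muln1.
rewrite mean_sum.
under eq_bigr => i _.
  under eq_mean do rewrite /mem imset_perm_comp.
  rewrite mean_mem card_imset; last exact: perm_inj.
  rewrite card_blk; last by lia.
  over.
rewrite sumr_const card_ord (addn1 m) (addn2 m) -[(_ *+ n)%R]mulr_natl !natrM.
set x := dens F m; set y := dens F m.+1; set z := dens F m.+2.
have pos k : 0 < k -> (0 < k%:R :> rat)%R by rewrite ltr0n.
have sl0 : (0 < (s - 2)%:R :> rat)%R by apply: pos; lia.
have q0 := pos q q_gt0.
by move=> le; rewrite -(ler_pM2l (mulr_gt0 sl0 q0)); lra.
Qed.

(** An [h]-set with [h < m] and [s - 1] sets of size [m + 1] fit disjointly into [n] points; if the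
    first is a member, one of the others is missing. For [h = m] there is one point too few, which
    is why level [m] needs the circle. *)
Lemma level_below h : h < m ->
  (dens F h <= (s - 1)%:R * (1 - dens F m.+1))%R.
Proof.
move=> hm; pose B (i : nat) := blk n (h + i * m.+1) m.+1.
have Bn (i : 'I_(s - 1)) : h + i * m.+1 + m.+1 <= n.
  have := leq_mulS_lt m.+1 (ltn_ord i); rewrite mulnBl mul1n mulnS nE.
  have : m.+1 <= s * m.+1 by rewrite leq_pmull; lia.
  by rewrite mulnS; lia.
have bound (t : {perm 'I_n}) : (t @: blk n 0 h \in F) <=
    \sum_(i < s - 1) (t @: B i \notin F).
  case hF : (_ \in F) => //=; rewrite lt0n sum_nat_eq0.
  apply/negP => /forall_inP allB; case/negP: F_s.
  apply: (has_matching_fin (A := fun o : option 'I_(s - 1) =>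
    if o is Some i then t @: B i else t @: blk n 0 h)).
  - by rewrite card_option card_ord; lia.
  - by case=> [i|//]; have := allB i isT; case: (_ \in F).
  have dB (i j : 'I_(s - 1)) : i != j -> [disjoint t @: B i & t @: B j].
    move=> /(ord_separated m.+1)[] ij; last rewrite disjoint_sym.
      by apply: disjoint_imset; [exact: perm_inj | apply: disjoint_blk; lia].
    by apply: disjoint_imset; [exact: perm_inj | apply: disjoint_blk; lia].
  have d0 (i : 'I_(s - 1)) : [disjoint t @: blk n 0 h & t @: B i].
    by apply: disjoint_imset; [exact: perm_inj | apply: disjoint_blk; lia].
  by case=> [i|] [j|] //= ij; [apply: dB | rewrite disjoint_sym].
have := ler_mean bound; rewrite mean_mem mean_sum card_blk; last first.
  by lia.
under eq_bigr => i _ do rewrite mean_notin card_blk // .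
by rewrite sumr_const card_ord -[(_ *+ _)%R]mulr_natl.
Qed.

(** C(n - 1, m - 1) is the share m/n of level [m], the constant term of [level_circle]. The two
    conditions on binomials say that a unit of density missing on level [m + 1], respectively
    [m + 2], removes at least as many sets there as it permits on the levels up to [m]. *)
Lemma card_le_circle c0 c1 c2 (P : {set {set 'I_n}}) :
  (forall t : nat -> bool, (forall x, t (x + n) = t x) ->
     (forall i, \sum_(j < s) t (i + j * m) < s) ->
     c0 * \sum_(i < n) t i <= c0 * m
       + c1 * \sum_(i < n) (2 <= \sum_(j < s) t (i + j * m))
       + c2 * \sum_(i < n) (s + 2 <= 2 * \sum_(j < s) t (i + j * m))) ->
  0 < c0 ->
  c0 * (s - 1) * \sum_(h < m) 'C(n, h) + c1 * s * 'C(n, m) <= c0 * 'C(n, m.+1) ->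
  c2 * s * 'C(n, m) <= c0 * 'C(n, m.+2) ->
  (forall A : {set 'I_n}, m < #|A| -> A \in P) ->
  'C(n.-1, m.-1) <= level P m -> #|F| <= #|P|.
Proof.
move=> /level_circle circle c0_gt0 C1 C2 Pbig Pm.
apply: (@card_le_low _ _ _ m.+2) => [A mA|]; first by apply: Pbig; lia.
rewrite !low_rec /low !big_ord_recr /=.
rewrite (@level_full _ P m.+1) => [|A Am]; last by rewrite Pbig ?Am.
rewrite (@level_full _ P m.+2) => [|A Am]; last by rewrite Pbig ?Am // ltnW.
apply: (@leq_trans ('C(n.-1, m.-1) + 'C(n, m.+1) + 'C(n, m.+2))); last first.
  by rewrite !leq_add2r; apply: leq_trans Pm (leq_addl _ _).
have pos k : 0 < k -> (0 < k%:R :> rat)%R by rewrite ltr0n.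
have n0 := pos _ n_gt0; have c00 := pos _ c0_gt0.
have binE : (n%:R * 'C(n.-1, m.-1)%:R = m%:R * 'C(n, m)%:R :> rat)%R.
  by rewrite -!natrM mul_bin_pred.
have lowF : ((\sum_(h < m) level F h)%:R <=
    (s - 1)%:R * (1 - dens F m.+1) * (\sum_(h < m) 'C(n, h))%:R :> rat)%R.
  rewrite !natr_sum mulr_sumr; apply: ler_sum => h _.
  rewrite levelE; last by have := ltn_ord h; lia.
  by rewrite ler_wpM2r ?ler0n // level_below.
have b1 : (0 <= 1 - dens F m.+1)%R by rewrite subr_ge0 dens_le1.
have b2 : (0 <= 1 - dens F m.+2)%R by rewrite subr_ge0 dens_le1.
rewrite -(ler_nat rat) !natrD.
rewrite (levelE F (h := m)); last by lia.
rewrite (levelE F (h := m.+1)); last by lia.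
rewrite (levelE F (h := m.+2)) //.
have {}C1 : (c0%:R * (s - 1)%:R * (\sum_(h < m) 'C(n, h))%:R
     + c1%:R * s%:R * 'C(n, m)%:R <= c0%:R * 'C(n, m.+1)%:R :> rat)%R.
  by rewrite -!natrM -natrD ler_nat.
have {}C2 : (c2%:R * s%:R * 'C(n, m)%:R <= c0%:R * 'C(n, m.+2)%:R :> rat)%R.
  by rewrite -!natrM ler_nat.
rewrite !natrM in circle.
have := ler_wpM2r (ler0n _ 'C(n, m)) circle.
have := ler_wpM2l b1 C1; have := ler_wpM2l b2 C2.
have := ler_wpM2l (ltW c00) lowF.
move: (dens F m) (dens F m.+1) (dens F m.+2) => x y z.
move: 'C(n, m)%:R%R 'C(n, m.+1)%:R%R 'C(n, m.+2)%:R%R 'C(n.-1, m.-1)%:R%R binE.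
move=> B B1 B2 B' binE leL le2 le1 leC.
rewrite -(ler_pM2l c00) -(ler_pM2l n0).
have := ler_wpM2l (ltW n0) leL; have := ler_wpM2l (ltW n0) le1.
have := ler_wpM2l (ltW n0) le2.
have : (c0%:R * (n%:R * B') = c0%:R * (m%:R * B) :> rat)%R by rewrite binE.
move=> e l2 l1 lL; move: e l2 l1 lL leC; clear; lra.
Qed.

End Two.

Lemma bin_ratio s m (n := s * m + s - 2) : 3 < s -> 0 < m ->
  [/\ ((s - 2) * m.+1).+1 * \sum_(h < m) 'C(n, h) <= m * 'C(n, m),
      m.+1 * 'C(n, m.+1) = ((s - 1) * m.+1 - 1) * 'C(n, m)
    & m.+2 * 'C(n, m.+2) = ((s - 1) * m.+1 - 2) * 'C(n, m.+1)].
Proof.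
move=> s3 m0; have sm := leq_mul s3 (leqnn m).
have sm1 : (s - 1) * m.+1 = s * m + s - m.+1 by rewrite mulnBl mul1n mulnS addnC.
have sm2 : (s - 2) * m.+1 = s * m + s - 2 * m.+1 by rewrite mulnBl mulnS addnC.
split; first 1 last.
- by rewrite mul_bin_left; congr (_ * _); rewrite /n; lia.
- by rewrite mul_bin_left; congr (_ * _); rewrite /n; lia.
have := @sum_bin_lt n m; rewrite (_ : n.+1 - 2 * m = ((s - 2) * m.+1).+1).
  by apply; rewrite /n; lia.
by rewrite /n; lia.
Qed.

(* After clearing denominators, the difference of the two sides is a polynomial
   with nonnegative coefficients in [a = s - 5] and [b = m - 1]; the other
   [bin_budget] lemmas are proved in the same way. *)
Lemma bin_budget5 s m (n := s * m + s - 2) : 4 < s -> 0 < m ->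
  2 * s ^ 2 * (s - 1) * \sum_(h < m) 'C(n, h) + (s ^ 2 + s - 4) * s * 'C(n, m)
    <= 2 * s ^ 2 * 'C(n, m.+1) /\
  s * (s - 3) * s * 'C(n, m) <= 2 * s ^ 2 * 'C(n, m.+2).
Proof.
move=> s4 m0; have [] := @bin_ratio s m (ltnW s4) m0; rewrite -/n.
move: (\sum_(h < m) _) 'C(n, m) 'C(n, m.+1) 'C(n, m.+2) => S C C1 C2.
have [a sE] : exists a, s = a + 5 by exists (s - 5); lia.
have [b mE] : exists b, m = b + 1 by exists (m - 1); lia.
clear n; subst s m.
rewrite (_ : a + 5 - 1 = a + 4); last by lia.
rewrite (_ : a + 5 - 2 = a + 3); last by lia.
rewrite (_ : a + 5 - 3 = a + 2); last by lia.
rewrite (_ : (a + 5) ^ 2 + (a + 5) - 4 = a ^ 2 + 11 * a + 26); last first.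
  by rewrite (_ : (a + 5) ^ 2 + (a + 5) = a ^ 2 + 11 * a + 26 + 4) ?addnK //; ring.
rewrite (_ : (b + 1).+2 = b + 3); last by lia.
rewrite (_ : (b + 1).+1 = b + 2); last by lia.
rewrite (_ : (a + 4) * (b + 2) - 1 = a * b + 2 * a + 4 * b + 7); last first.
  by rewrite (_ : (a + 4) * (b + 2) = a * b + 2 * a + 4 * b + 7 + 1) ?addnK //; ring.
rewrite (_ : (a + 4) * (b + 2) - 2 = a * b + 2 * a + 4 * b + 6); last first.
  by rewrite (_ : (a + 4) * (b + 2) = a * b + 2 * a + 4 * b + 6 + 2) ?addnK //; ring.
rewrite -[((a + 3) * (b + 2)).+1]addn1.
set v := (a + 3) * (b + 2) + 1 => vS dC1 dC2; split.
  rewrite -(@leq_pmul2l (v * (b + 2))); last by rewrite muln_gt0 /v; lia.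
  have -> : v * (b + 2) * (2 * (a + 5) ^ 2 * C1) =
      v * (2 * (a + 5) ^ 2) * ((b + 2) * C1) by ring.
  rewrite dC1.
  have le1 : (b + 2) * (2 * (a + 5) ^ 2 * (a + 4)) * (v * S) <=
             (b + 2) * (2 * (a + 5) ^ 2 * (a + 4)) * ((b + 1) * C).
    by rewrite leq_mul2l vS orbT.
  apply: leq_trans (_ : (b + 2) * (2 * (a + 5) ^ 2 * (a + 4)) * ((b + 1) * C)
     + (a ^ 2 + 11 * a + 26) * (a + 5) * v * (b + 2) * C <= _).
    rewrite mulnDr; apply: leq_add; last by apply: eq_leq; ring.
    by apply: leq_trans le1; apply: eq_leq; ring.
  rewrite /v.
  apply: leq_trans (leq_addr ((a + 5) * C * (46 + 84*a + 32*b + 34*a*a + 77*a*b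
    + 2*b*b + 4*a*a*a + 33*a*a*b + 17*a*b*b + 4*a*a*a*b + 8*a*a*b*b
    + 1*a*a*a*b*b)) _) _.
  by apply: eq_leq; ring.
rewrite -(@leq_pmul2l ((b + 2) * (b + 3))); last by rewrite muln_gt0; lia.
have -> : (b + 2) * (b + 3) * (2 * (a + 5) ^ 2 * C2) =
  (b + 2) * (2 * (a + 5) ^ 2) * ((b + 3) * C2) by ring.
rewrite dC2.
have -> : (b + 2) * (2 * (a + 5) ^ 2) * ((a * b + 2 * a + 4 * b + 6) * C1) =
  (2 * (a + 5) ^ 2) * (a * b + 2 * a + 4 * b + 6) * ((b + 2) * C1) by ring.
rewrite dC1.
apply: leq_trans (leq_addr ((a + 5) ^ 2 * C * (72 + 46*a + 94*b + 8*a*a + 53*a*b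
   + 30*b*b + 8*a*a*b + 15*a*b*b + 2*a*a*b*b)) _) _.
by apply: eq_leq; ring.
Qed.

Lemma bin_budget4 m (n := 4 * m + 4 - 2) : 1 < m ->
  3 * (4 - 1) * \sum_(h < m) 'C(n, h) + 1 * 4 * 'C(n, m) <= 3 * 'C(n, m.+1) /\
  1 * 4 * 'C(n, m) <= 3 * 'C(n, m.+2).
Proof.
move=> m1; have [] := @bin_ratio 4 m isT (ltnW m1); rewrite -/n.
move: (\sum_(h < m) _) 'C(n, m) 'C(n, m.+1) 'C(n, m.+2) => S C C1 C2.
have [b mE] : exists b, m = b + 2 by exists (m - 2); lia.
clear n; subst m.
rewrite (_ : (4 - 1) * (b + 2).+1 - 1 = 3 * b + 8); last by lia.
rewrite (_ : (4 - 1) * (b + 2).+1 - 2 = 3 * b + 7); last by lia.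
rewrite (_ : ((4 - 2) * (b + 2).+1).+1 = 2 * b + 7); last by lia.
rewrite (_ : (b + 2).+2 = b + 4); last by lia.
rewrite (_ : (b + 2).+1 = b + 3); last by lia.
rewrite (_ : 4 - 1 = 3) // => vS dC1 dC2; split.
  rewrite -(@leq_pmul2l ((2 * b + 7) * (b + 3))); last by rewrite muln_gt0; lia.
  have -> : (2 * b + 7) * (b + 3) * (3 * C1) = 3 * (2 * b + 7) * ((b + 3) * C1) by ring.
  rewrite dC1.
  have le1 : (b + 3) * 9 * ((2 * b + 7) * S) <= (b + 3) * 9 * ((b + 2) * C).
    by rewrite leq_mul2l vS orbT.
  apply: leq_trans (_ : (b + 3) * 9 * ((b + 2) * C)
     + 4 * (2 * b + 7) * (b + 3) * C <= _).
    rewrite mulnDr; apply: leq_add; last by apply: eq_leq; ring.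
    by apply: leq_trans le1; apply: eq_leq; ring.
  by apply: leq_trans (leq_addr (C * (30 + 14 * b + b * b)) _) _; apply: eq_leq; ring.
rewrite -(@leq_pmul2l ((b + 3) * (b + 4))); last by rewrite muln_gt0; lia.
have -> : (b + 3) * (b + 4) * (3 * C2) = 3 * (b + 3) * ((b + 4) * C2) by ring.
rewrite dC2.
have -> : 3 * (b + 3) * ((3 * b + 7) * C1) = 3 * (3 * b + 7) * ((b + 3) * C1) by ring.
rewrite dC1.
by apply: leq_trans (leq_addr (C * (120 + 107 * b + 23 * b * b)) _) _; apply: eq_leq; ring.
Qed.

Lemma card_star n (z : 'I_n) h :
  #|[set A : {set 'I_n} | (z \in A) && (#|A| == h.+1)]| = 'C(n.-1, h).
Proof.
have n0 : 0 < n by apply: leq_ltn_trans (ltn_ord z).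
have := cardsID [set A : {set 'I_n} | z \in A]
                [set A : {set 'I_n} | A \subset setT & #|A| == h.+1].
have -> : #|[set A : {set 'I_n} | A \subset setT & #|A| == h.+1]| =
          'C(n.-1, h.+1) + 'C(n.-1, h).
  by rewrite cards_draws cardsT card_ord -binS prednK.
rewrite addnC.
have -> : #|[set A : {set 'I_n} | A \subset setT & #|A| == h.+1] :\:
           [set A : {set 'I_n} | z \in A]| = 'C(n.-1, h.+1).
  rewrite -[n in n.-1]card_ord -(cardsC1 z) -cards_draws; apply: eq_card => A.
  by rewrite !inE subsetT subsetC sub1set inE.
by move/addnI => <-; apply: eq_card => A; rewrite !inE subsetT andbC.
Qed.

Lemma leq_sum_cardI (T I : finType) (A : I -> {set T}) (B : {set T}) :
  (forall i j, i != j -> [disjoint A i & A j]) ->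
  \sum_i #|A i :&: B| <= #|B|.
Proof.
move=> dA.
have E i : #|A i :&: B| = \sum_(x in B) (x \in A i).
  rewrite -sum1_card (eq_bigl (fun x => (x \in B) && (x \in A i))).
    by rewrite big_mkcondr.
  by move=> x; rewrite inE andbC.
under eq_bigr do rewrite E.
rewrite exchange_big -[leqRHS]sum1_card /=; apply: leq_sum => x _.
case: (pickP (fun i => x \in A i)) => [i xi|xA]; last first.
  by rewrite big1 // => i _; rewrite xA.
rewrite (bigD1 i) //= big1 ?addn0 ?leq_b1 // => j ji; apply/eqP; rewrite eqb0.
by apply/negP => /(disjoint_false (dA j i ji)).
Qed.

(** * The family [calP] and the conclusion for [l = 2] *)

Lemma e_eq n s (P : {set {set 'I_n}}) :
  ~~ has_matching P s ->
  (forall F : {set {set 'I_n}}, ~~ has_matching F s -> #|F| <= #|P|) ->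
  e n s = #|P|.
Proof.
move=> Ps ub; apply/eqP; rewrite eqn_leq /e; apply/andP; split.
  by apply/bigmax_leqP => F; rewrite matching_number_ltE => /ub.
apply: (leq_bigmax_cond (F := fun F : {set {set 'I_n}} => #|F|)).
by rewrite matching_number_ltE.
Qed.

Lemma set0_notin n (F : {set {set 'I_n}}) s : ~~ has_matching F s -> set0 \notin F.
Proof.
apply: contra => F0; apply: (has_matching_fin (A := fun _ : 'I_s => set0)).
- by rewrite card_ord.
- by [].
- by move=> i j _; rewrite -setI_eq0 setI0.
Qed.

Section CalP.

Variables s m l : nat.
Hypothesis ls : 0 < l <= s.
Let n := s * m + s - l.

Lemma card_segment : #|segment n (l - 1)| <= l - 1.
Proof.
have -> : segment n (l - 1) = blk n 0 (l - 1) by apply/setP => x; rewrite !inE.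
have [ln|nl] := leqP (l - 1) n; first by rewrite card_blk.
by apply: leq_trans (max_card _) _; rewrite card_ord ltnW.
Qed.

(** Over [s] disjoint members the weights |A| + |A :&: [l - 1]| would add up to at least s(m + 1),
    but they add up to at most n + l - 1 = s(m + 1) - 1. *)
Lemma calP_matching : ~~ has_matching (calP s m l) s.
Proof.
apply/negP => /has_matchingP[A [AP dA]].
have dA' i j : i != j -> [disjoint A i & A j].
  by move=> /eqP ij; rewrite -setI_eq0 dA.
have := leq_sum_cardI setT dA'; have := leq_sum_cardI (segment n (l - 1)) dA'.
rewrite cardsT card_ord -/n => le1 le2.
have : \sum_(i < s) (m + 1) <=
       \sum_(i < s) (#|A i :&: setT| + #|A i :&: segment n (l - 1)|).
  by apply: leq_sum => i _; have := AP i; rewrite inE setIT.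
rewrite sum_nat_const card_ord big_split /= => le3.
have := leq_trans le3 (leq_add le2 (leq_trans le1 card_segment)).
by rewrite /n mulnDr muln1; have := ls; lia.
Qed.

Lemma calP_big (A : {set 'I_n}) : m < #|A| -> A \in calP s m l.
Proof. by move=> mA; rewrite inE; apply: leq_trans (leq_addr _ _); rewrite addn1. Qed.

End CalP.

Lemma e_calP_l2 (s m : nat) : 0 < m ->
  4 < s \/ (s = 4 /\ ~~ odd m) ->
  e (s * m + s - 2) s = #|calP s m 2|.
Proof.
move=> m0 sm; have s3 : 3 < s by case: sm => [/ltnW//|[-> _]].
set n := s * m + s - 2.
have nE : n = s * m + s - 2 by [].
have ls : 0 < 2 <= s by lia.
apply: (e_eq (calP_matching m ls)) => F Fs.
have n0 : 0 < n by rewrite nE; have := muln_gt0 s m; lia.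
have Pm : 'C(n.-1, m.-1) <= level (calP s m 2) m.
  rewrite -(card_star (Ordinal n0)) prednK //.
  apply/subset_leq_card/subsetP => A; rewrite !inE => /andP[zA /eqP ->].
  rewrite eqxx andbT leq_add2l card_gt0; apply/set0Pn.
  by exists (Ordinal n0); rewrite !inE zA.
have [s4|[s4 m_even]] : 4 < s \/ (s = 4 /\ ~~ odd m) := sm.
  have [C1 C2] := bin_budget5 s4 m0.
  apply: (card_le_circle nE Fs s3 m0 _ _ C1 C2 (@calP_big s m 2) Pm); last by lia.
  by move=> t tP t_lt; apply: circle_bound.
have m1 : 1 < m by case: (m) m0 m_even => [|[|]].
have := bin_budget4 m1; rewrite -s4 => -[C1 C2].
apply: (card_le_circle nE Fs s3 m0 _ _ C1 C2 (@calP_big s m 2) Pm) => //.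
move=> t tP t_lt; have mE : m = (m./2).*2 by rewrite -[LHS]odd_double_half (negbTE m_even).
rewrite !mul1n; rewrite /n s4 mE in tP t_lt *.
exact: circle_bound4.
Qed.

(** * The case m = 1 *)

Lemma level1E n (F : {set {set 'I_n}}) :
  level F 1 = #|[set x | [set x] \in F]|.
Proof.
rewrite -(card_imset _ set1_inj); apply: eq_card => A; rewrite !inE.
apply/andP/imsetP => [[AF /cards1P[x Ax]]|[x + ->]].
  by exists x; rewrite ?inE -?Ax.
by rewrite inE cards1.
Qed.

(** A permutation brings the points whose singletons are members to the front. Since
    [level F 1 < s], level [1] exceeds [l - 1], a lower bound for the singletons in [calP], by at
    most [s - l], and this is also the number of missing pairs. *)
Lemma level2_missing s l (n := s * 1 + s - l) (F : {set {set 'I_n}}) :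
  0 < l <= s -> ~~ has_matching F s -> l <= level F 1 ->
  level F 1 < s /\ level F 2 + (s - l) <= 'C(n, 2).
Proof.
move=> ls Fs; set k := level F 1; set K := [set x | [set x] \in F].
have kE : k = #|K| := level1E F.
have kn : k <= n by rewrite kE -[n in _ <= n]card_ord max_card.
have [t tK] : exists t : {perm 'I_n}, t @: blk n 0 k = K.
  by apply: ex_perm_imset; rewrite card_blk.
have Fs' := has_matching_perm t Fs.
pose R := [set i : 'I_s | blk n (i * 1) 1 \in pull t F].
have RP (i : 'I_s) : i < k -> i \in R.
  move=> ik; have iN : i < n by lia.
  have blkE : blk n (i * 1) 1 = [set Ordinal iN].
    by apply/setP => x; rewrite !inE -val_eqE /= muln1; lia.
  have : t (Ordinal iN) \in K by rewrite -tK mem_imset ?inE //; apply: perm_inj.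
  by rewrite !inE blkE imset_set1.
have few := few_blocks Fs' (leqnn 1); rewrite -/R in few.
have ks : k < s.
  rewrite ltnNge; apply/negP => sk; move: few.
  suff -> : R = setT by rewrite cardsT card_ord ltnn.
  by apply/setP => i; rewrite RP ?in_setT // (leq_trans (ltn_ord i)).
have kR : k <= #|R|.
  rewrite -[k]card_ord -cardsT.
  have wi : injective (widen_ord (ltnW ks)).
    by move=> i j /(congr1 val) /= /val_inj.
  rewrite -(card_imset _ wi); apply/subset_leq_card/subsetP => i.
  by move=> /imsetP[j _ ->]; apply: RP => /=.
move=> lk; split=> //.
have sl : 0 < s - l by lia.
have Rq : s - #|R| <= s - l by lia.
have := many_missing Fs' 1 (leqnn 1) sl Rq.
pose B (p : 'I_s * 'I_(s - l)) : {set 'I_n} :=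
  blk n (p.1 * 1) 1 :|: blk n (s * 1 + p.2 * 1) 1.
have mem1 a (x : 'I_n) : (x \in blk n a 1) = (x == a :> nat).
  by rewrite inE; apply/idP/eqP; lia.
have ltB (p : 'I_s * 'I_(s - l)) : (p.1 < n) && (s + p.2 < n).
  by have := ltn_ord p.1; have := ltn_ord p.2; lia.
have B_inj : injective B.
  move=> p q Bpq; have /andP[p1 p2] := ltB p.
  have : Ordinal p1 \in B q by rewrite -Bpq in_setU mem1 /= muln1 eqxx.
  have : Ordinal p2 \in B q by rewrite -Bpq in_setU !mem1 /= !muln1 eqxx orbT.
  rewrite !in_setU !mem1 /= !muln1 => e2 e1.
  have := ltn_ord p.1; have := ltn_ord q.1 => q1s p1s.
  case: p q {Bpq p1 p2} e1 e2 q1s p1s => [p1 p2] [q1 q2] /= e1 e2 q1s p1s.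
  by congr (_, _); apply: val_inj => /=; lia.
rewrite pair_bigA /=.
have -> : \sum_(p : 'I_s * 'I_(s - l)) (B p \notin pull t F) =
    #|[set p | B p \notin pull t F]|.
  by rewrite -big_mkcond sum1_card cardsE.
have tB_inj : injective (fun p => t @: B p).
  by move=> p q /(imset_inj (@perm_inj _ t))/B_inj.
rewrite -(card_imset _ tB_inj) => le_sl.
apply: leq_trans (leq_add (leqnn _) le_sl) _.
rewrite -[n in 'C(n, _)]card_ord -cardsT -cards_draws.
rewrite -(cardsID F [set A : {set 'I_n} | _ & _]) leq_add //.
  by apply/subset_leq_card/subsetP => A; rewrite !inE subsetT andbC.
apply/subset_leq_card/subsetP => A /imsetP[p + ->]; rewrite !inE subsetT => -> /=.
rewrite card_imset; last exact: perm_inj.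
have /andP[p1 p2] := ltB p; rewrite blkU_card ?muln1 // addn1 //.
exact: leq_trans (ltn_ord p.1) (leq_addr _ _).
Qed.

Lemma e_calP_m1 s l : 0 < l <= s -> e (s * 1 + s - l) s = #|calP s 1 l|.
Proof.
move=> ls; apply: (e_eq (calP_matching 1 ls)) => F Fs.
apply: (@card_le_low _ _ _ 2) => [A A2|]; first exact/calP_big/ltnW.
rewrite !low_rec /low !big_ord1 (level_set0 (set0_notin Fs)) add0n.
rewrite [level (calP _ _ _) 2]level_full => [|A A2]; last first.
  by apply: calP_big; rewrite A2.
have P1 : l - 1 <= level (calP s 1 l) 1.
  have <- : #|blk (s * 1 + s - l) 0 (l - 1)| = l - 1 by rewrite card_blk //; lia.
  rewrite level1E; apply/subset_leq_card/subsetP => x; rewrite !inE add0n => xl.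
  rewrite cards1 (_ : [set x] :&: _ = [set x]) ?cards1 //.
  by apply/setIidPl; rewrite sub1set inE.
have [lk|kl] := leqP l (level F 1).
  by have [] := level2_missing ls Fs lk; lia.
by have := level_le F 2; lia.
Qed.

(** * Members of large total deficit *)

(* With the deficit [m + 1 - |A|] of a set [A], the last condition says that the
   sets [D j], [j \in J], have total deficit at least [l]. *)
Definition heavy n (F : {set {set 'I_n}}) (m l : nat) :=
  exists (J : {set 'I_l}) (D : 'I_l -> {set 'I_n}),
    [/\ forall j, j \in J -> D j \in F,
        forall i j, i \in J -> j \in J -> i != j -> [disjoint D i & D j]
      & \sum_(j in J) #|D j| + l <= #|J| * m.+1].

Lemma level_partition N q k (G : {set {set 'I_N}}) : 0 < q -> 0 < k ->
  q * k <= N -> ~~ has_matching G q ->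
  level G k + 'C(q * k - 1, k - 1) <= 'C(N, k).
Proof.
move=> q0 k0 qkN Gq.
have kN : k <= N by apply: leq_trans qkN; rewrite leq_pmull.
have Bn (i : 'I_q) : i * k + k <= N.
  exact: leq_trans (leq_mulS_lt k (ltn_ord i)) qkN.
have bound (t : {perm 'I_N}) : 1 <= \sum_(i < q) (t @: blk N (i * k) k \notin G).
  rewrite lt0n sum_nat_eq0; apply/negP => /forall_inP allB; case/negP: Gq.
  apply: (has_matching_fin (A := fun i : 'I_q => t @: blk N (i * k) k)).
  - by rewrite card_ord.
  - by move=> i; have := allB i isT; case: (_ \in G).
  move=> i j /(ord_separated k)[] ij; last rewrite disjoint_sym.
    by apply: disjoint_imset; [exact: perm_inj | apply: disjoint_blk; lia].
  by apply: disjoint_imset; [exact: perm_inj | apply: disjoint_blk; lia].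
have := ler_mean bound; rewrite mean_cst mean_sum.
under eq_bigr => i _ do rewrite mean_notin card_blk //.
rewrite sumr_const card_ord -[(_ *+ _)%R]mulr_natl => le1.
have C0 : (0 < 'C(N, k)%:R :> rat)%R by rewrite ltr0n bin_gt0.
have le2 : 'C(N, k) + q * level G k <= q * 'C(N, k).
  rewrite -(ler_nat rat) natrD !natrM levelE //.
  by have := ler_wpM2r (ltW C0) le1; lra.
have : 'C(q * k, k) <= 'C(N, k) by apply: leq_bin2l.
have : q * k * 'C((q * k).-1, k.-1) = k * 'C(q * k, k) by apply: mul_bin_pred.
rewrite -!subn1 -mulnA mulnCA => /eqP; rewrite eqn_pmul2l // => /eqP <- le3.
rewrite -(leq_pmul2l q0) mulnDr.
by apply: leq_trans le2; rewrite addnC leq_add2r.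
Qed.

(** As n = s(m + 1) - l, the sets [D j] leave a set [V] of at least (s - |J|)(m + 1) points. Inside
    [V] there are no s - |J| disjoint members, since they would complete the [D j] to [s] of them.
    So [level_partition] applies in [V], and |J| <= l makes its bound uniform. *)
Lemma heavy_missing n s m l (F : {set {set 'I_n}}) :
  n = s * m + s - l -> l < s -> ~~ has_matching F s -> heavy F m l ->
  level F m.+1 + 'C((s - l) * m.+1 - 1, m) <= 'C(n, m.+1).
Proof.
move=> nE ls Fs [J [D [DF dD sumD]]].
pose V := ~: \bigcup_(j in J) D j; pose q := s - #|J|.
have Jl : #|J| <= l by rewrite -[l in _ <= l]card_ord max_card.
have cV : q * m.+1 <= #|V|.
  have := cardsC (\bigcup_(j in J) D j); rewrite card_ord -/V.
  have : #|\bigcup_(j in J) D j| <= \sum_(j in J) #|D j|.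
    exact: leq_card_bigcup.
  have : #|J| * m.+1 <= s * m.+1 by rewrite leq_mul2r; lia.
  rewrite /q mulnBl (mulnS s) [s + _]addnC.
  by move: #|V| #|\bigcup_(j in J) D j| (\sum_(j in J) _) (#|J| * _) sumD; lia.
pose f (x : 'I_#|V|) : 'I_n := enum_val x.
have f_inj : injective f by apply: enum_val_inj.
have fV x : f x \in V by apply: enum_valP.
have Gq : ~~ has_matching (pull f F) q.
  apply: contra Fs => /has_matchingP[A [AF dA]].
  apply: (has_matching_fin (A := fun x : {j | j \in J} + 'I_q =>
    match x with inl j => D (val j) | inr i => f @: A i end)).
  - have cJ : #|{: {j | j \in J}}| = #|J| by rewrite card_sig; apply: eq_card.
    by rewrite card_sum cJ card_ord -leq_subLR.
  - by case=> [[j jJ]|i] /=; [apply: DF | have := AF i; rewrite inE].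
  have dV j i : j \in J -> [disjoint D j & f @: A i].
    move=> jJ; apply: disjoint_of => x xj /imsetP[y _ xy].
    have := fV y; rewrite -xy inE => /negP; apply.
    by apply/bigcupP; exists j.
  case=> [[i iJ]|i] [[j jJ]|j] //= ij.
  - by apply: dD.
  - exact: dV.
  - by rewrite disjoint_sym; apply: dV.
  apply: disjoint_imset => //; rewrite -setI_eq0; apply/eqP/dA => eij.
  by rewrite eij eqxx in ij.
have q0 : 0 < q by rewrite /q; lia.
have := level_partition q0 (ltn0Sn m) cV Gq; rewrite [m.+1 - 1]subn1 /=.
have : 'C((s - l) * m.+1 - 1, m) <= 'C(q * m.+1 - 1, m).
  apply: leq_bin2l; apply: leq_sub2r; rewrite leq_mul2r; apply/orP; right.
  by rewrite /q; lia.
suff : #|[set A : {set 'I_#|V|} | A \notin pull f F & #|A| == m.+1]| <=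
       #|[set A : {set 'I_n} | A \notin F & #|A| == m.+1]|.
  have E N (G : {set {set 'I_N}}) :
      level G m.+1 + #|[set A : {set 'I_N} | A \notin G & #|A| == m.+1]| = 'C(N, m.+1).
    rewrite -[N in 'C(N, _)]card_ord -cardsT -cards_draws.
    apply: etrans (cardsID G _); rewrite /level.
    by congr (_ + _); apply: eq_card => A; rewrite !inE subsetT andbC.
  move=> le_miss le_bin; rewrite -(E _ (pull f F)) leq_add2l => le_b.
  by rewrite -(E _ F) leq_add2l (leq_trans le_bin) // (leq_trans le_b).
rewrite -(card_imset _ (imset_inj f_inj)).
apply/subset_leq_card/subsetP => B /imsetP[A + ->]; rewrite !inE => /andP[-> /=].
by rewrite card_imset.
Qed.

(** The second term bounds the number of [m]-sets in [a + k] points that meet a fixed [k]-set,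
    counted through each of its points. *)
Lemma bin_diff a k m : 0 < m ->
  'C(a + k, m) <= 'C(a, m) + k * 'C((a + k).-1, m.-1).
Proof.
case: m => // m _; elim: k => [|k IHk]; first by rewrite addn0 mul0n addn0.
rewrite addnS binS /= mulSn [leqRHS]addnCA [leqLHS]addnC leq_add2l.
apply: leq_trans IHk _; rewrite leq_add2l leq_mul2l /=; apply/orP; right.
by apply: leq_bin2l; lia.
Qed.

(** The sets missing on level [m + 1] are split. By the first inequality two thirds of them pay for
    the term of [level_excess] in [1 - dens F m.+1]. By the second, the remaining third pays for its
    constant term, as [heavy_missing] provides ['C((s - l) * m.+1 - 1, m)] missing sets. The third
    inequality lets level [m + 2] pay for the last term. *)
Lemma bin_budget_heavy s m l (n := s * m + s - l) :
  0 < l -> 0 < m -> l * m + 3 * l + 3 <= s ->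
  [/\ 3 * (\sum_(h < m.+1) 'C(n, h) * (s - l + 1)) <= 4 * 'C(n, m.+1),
      3 * (\sum_(h < m.+1) 'C(n, h) * (l - 1)) <=
        s * 'C((s - l) * m.+1 - 1, m)
    & \sum_(h < m.+1) 'C(n, h) * (s - l - 1) <= 2 * 'C(n, m.+2)].
Proof.
move=> l0 m0 sl.
have [c lE] : exists c, l = c + 1 by exists (l - 1); lia.
have [b mE] : exists b, m = b + 1 by exists (m - 1); lia.
have [t sE] : exists t, s = 7 + b + 4 * c + t + b * c.
  exists (s - (l * m + 3 * l + 3)); move: sl.
  have -> : l * m + 3 * l + 3 = 7 + b + 4 * c + b * c by rewrite lE mE; ring.
  by lia.
have nE : n = 13 + 9 * b + 7 * c + 2 * t + b ^ 2 + 6 * b * c + b * t + b ^ 2 * c.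
  rewrite /n (_ : s * m + s = 13 + 9 * b + 7 * c + 2 * t + b ^ 2 + 6 * b * c +
    b * t + b ^ 2 * c + l) ?addnK //.
  by rewrite sE lE mE; ring.
rewrite -!big_distrl /= big_ord_recr /=.
set S := \sum_(h < m) _; set C := 'C(n, m).
(* Hence 7(S + C) <= 8C: the factors 7 and 24 = 3 * 8 below come from here. *)
have S7 : 7 * S <= C.
  rewrite -(leq_pmul2l m0) -/C; apply: leq_trans (sum_bin_lt (n := n) (m := m) _).
    rewrite -/S mulnA leq_mul2r; apply/orP; right; rewrite nE mE.
    by move: (b ^ 2) (b * c) (b * t) (b ^ 2 * c) => ? ? ? ?; lia.
  rewrite nE mE.
  by move: (b ^ 2) (b * c) (b * t) (b ^ 2 * c) => ? ? ? ?; lia.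
have dC1 : m.+1 * 'C(n, m.+1) = (n - m) * C by rewrite mul_bin_left.
have dC2 : m.+2 * 'C(n, m.+2) = (n - m.+1) * 'C(n, m.+1) by rewrite mul_bin_left.
have uE : n - m = 12 + 8 * b + 7 * c + 2 * t + b ^ 2 + 6 * b * c + b * t + b ^ 2 * c.
  rewrite nE mE.
  by move: (b ^ 2) (b * c) (b * t) (b ^ 2 * c) => ? ? ? ?; lia.
have C1_le : 3 * ((S + C) * (s - l + 1)) <= 4 * 'C(n, m.+1).
  have wE : s - l + 1 = 7 + b + 3 * c + t + b * c.
    by rewrite sE lE; move: (b * c) => ?; lia.
  rewrite -(@leq_pmul2l (7 * m.+1)) //.
  have -> : 7 * m.+1 * (4 * 'C(n, m.+1)) = 28 * (m.+1 * 'C(n, m.+1)) by ring.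
  have le1 : 3 * m.+1 * (s - l + 1) * (7 * S) <= 3 * m.+1 * (s - l + 1) * C.
    by rewrite leq_mul2l S7 orbT.
  apply: leq_trans (_ : 24 * m.+1 * (s - l + 1) * C <= _).
    have -> : 24 * m.+1 * (s - l + 1) * C = 3 * m.+1 * (s - l + 1) * C +
      21 * m.+1 * (s - l + 1) * C by ring.
    by apply: leq_trans (leq_add le1 (leqnn _)); apply: eq_leq; ring.
  rewrite dC1 uE wE mE -addn1.
  apply: leq_trans (leq_addr (4 * C * (2 * b + 13 * c + 2 * t + b ^ 2 +
    12 * b * c + b * t + b ^ 2 * c)) _) _.
  by apply: eq_leq; ring.
split=> //.
  set L := 'C((s - l) * m.+1 - 1, m).
  have aE : n = (s - l) * m.+1 - 1 + (l * m + 1).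
    rewrite mulnBl /n mulnS mulnS [s * m + s]addnC.
    have : l * m <= s * m by rewrite leq_mul2r; apply/orP; right; lia.
    by move: (l * m) (s * m) sl => ? ?; lia.
  have := bin_diff ((s - l) * m.+1 - 1) (l * m + 1) m0; rewrite -aE -/C -/L.
  move=> /(leq_mul (leqnn n)); rewrite mulnDr mulnCA mul_bin_pred // -/C => leC.
  have {}leC : (n - (l * m + 1) * m) * C <= n * L.
    by rewrite mulnBl leq_subLR addnC -mulnA.
  have n0 : 0 < n by rewrite nE.
  rewrite -(@leq_pmul2l (7 * n)); last by rewrite muln_gt0.
  have -> : 7 * n * (s * L) = 7 * s * (n * L) by ring.
  apply: leq_trans (_ : 7 * s * ((n - (l * m + 1) * m) * C) <= _); last first.
    by rewrite leq_mul2l leC orbT.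
  have le1 : 3 * n * (l - 1) * (7 * S) <= 3 * n * (l - 1) * C.
    by rewrite leq_mul2l S7 orbT.
  apply: leq_trans (_ : 24 * n * (l - 1) * C <= _).
    have -> : 24 * n * (l - 1) * C = 3 * n * (l - 1) * C +
      21 * n * (l - 1) * C by ring.
    by apply: leq_trans (leq_add le1 (leqnn _)); apply: eq_leq; ring.
  have -> : n - (l * m + 1) * m = 11 + 6 * b + 6 * c + 2 * t + 4 * b * c + b * t.
    rewrite nE (_ : 13 + 9 * b + 7 * c + 2 * t + b ^ 2 + 6 * b * c + b * t +
      b ^ 2 * c = 11 + 6 * b + 6 * c + 2 * t + 4 * b * c + b * t +
      (l * m + 1) * m) ?addnK //.
    by rewrite lE mE; ring.
  rewrite nE sE lE addnK.
  apply: leq_trans (leq_addr (C * (539 + 371 * b + 290 * c + 175 * t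
    + 42 * b ^ 2 + 267 * b * c + 105 * b * t + 50 * c * t + 14 * t ^ 2
    + 46 * b ^ 2 * c + 7 * b ^ 2 * t + 10 * b * c ^ 2 + 46 * b * c * t
    + 7 * b * t ^ 2 + 4 * b ^ 2 * c ^ 2 + 7 * b ^ 2 * c * t)) _) _.
  by apply: eq_leq; ring.
have C12 : 'C(n, m.+1) <= 'C(n, m.+2).
  rewrite -(@leq_pmul2l m.+2) // dC2 leq_mul2r; apply/orP; right.
  rewrite nE mE; move: (b ^ 2) (b * c) (b * t) (b ^ 2 * c) => ? ? ? ?; lia.
have : (S + C) * (s - l - 1) <= (S + C) * (s - l + 1).
  by rewrite leq_mul2l; apply/orP; right; lia.
by move: ((S + C) * (s - l - 1)) ((S + C) * (s - l + 1)) C1_le => x y; lia.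
Qed.

Lemma card_le_heavy n s m l (F P : {set {set 'I_n}}) :
  n = s * m + s - l -> 0 < l -> 0 < m -> l * m + 3 * l + 3 <= s ->
  ~~ has_matching F s -> heavy F m l ->
  (forall A : {set 'I_n}, m < #|A| -> A \in P) -> #|F| <= #|P|.
Proof.
move=> nE l0 m0 sl Fs hF Pbig.
have ls : 0 < l < s by lia.
have s2 : 3 <= s - l by lia.
have mn : m.+2 <= n.
  have : l * m <= s * m by rewrite leq_mul2r; apply/orP; right; lia.
  have : 3 * m <= s * m by rewrite leq_mul2r; apply/orP; right; lia.
  by rewrite nE; lia.
have [] := bin_budget_heavy l0 m0 sl; rewrite -nE.
have hL := heavy_missing nE (proj2 (andP ls)) Fs hF.
move: hL; set L := 'C((s - l) * m.+1 - 1, m) => hL.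
rewrite -!big_distrl /=; set S := \sum_(h < m.+1) 'C(n, h) => N1 N2 N3.
apply: (@card_le_low _ _ _ m.+2) => [A mA|]; first by apply: Pbig; lia.
rewrite !low_rec (@level_full _ P m.+1) => [|A Am]; last by rewrite Pbig ?Am.
rewrite (@level_full _ P m.+2) => [|A Am]; last by rewrite Pbig ?Am // ltnW.
apply: (@leq_trans ('C(n, m.+1) + 'C(n, m.+2))); last first.
  by rewrite leq_add2r leq_addl.
set b1 := (1 - dens F m.+1)%R; set b2 := (1 - dens F m.+2)%R.
have b1_ge0 : (0 <= b1)%R by rewrite subr_ge0 dens_le1.
have b2_ge0 : (0 <= b2)%R by rewrite subr_ge0 dens_le1.
have lowF : ((2 * s)%:R * (low F m)%:R <= S%:R * ((2 * (l - 1))%:R +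
   ((s - l + 1) * s)%:R * b1 + ((s - l - 1) * s)%:R * b2) :> rat)%R.
  rewrite /low /S !natr_sum mulr_sumr mulr_suml; apply: ler_sum => h _.
  have hm : h <= m by rewrite -ltnS.
  rewrite levelE; last by lia.
  rewrite mulrA mulrC ler_wpM2l ?ler0n //.
  by apply: (level_excess nE Fs ls) => //; lia.
have lev1 : ((level F m.+1)%:R = (1 - b1) * 'C(n, m.+1)%:R :> rat)%R.
  by rewrite levelE ?/b1 ?subKr //; lia.
have lev2 : ((level F m.+2)%:R = (1 - b2) * 'C(n, m.+2)%:R :> rat)%R.
  by rewrite levelE ?/b2 ?subKr.
move: hL N1 N2 N3; rewrite -!(ler_nat rat) !natrD !natrM lev1 lev2 => hL N1 N2 N3.
rewrite !natrM in lowF.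
have s0 : (0 < s%:R :> rat)%R by rewrite ltr0n; lia.
rewrite -(ler_pM2l s0).
have := ler_wpM2l b1_ge0 N1; have := ler_wpM2l b2_ge0 N3.
have := ler_wpM2l (ltW s0) hL.
move: (s - l - 1)%:R%R (s - l + 1)%:R%R (l - 1)%:R%R N2 lowF.
move: S%:R%R L%:R%R (low F m)%:R%R 'C(n, m.+1)%:R%R 'C(n, m.+2)%:R%R.
move=> S' L' lo C1 C2 w1 w2 w3 N2 lowF hL' N3' N1'.
have := ler_wpM2l (ltW s0) N3'; have := ler_wpM2l (ltW s0) N1'.
move: lowF N2 hL'; clear; lra.
Qed.

(** * Shifting and shadows *)

Definition shifted n (F : {set {set 'I_n}}) :=
  forall (A : {set 'I_n}) (i j : 'I_n),
    A \in F -> i < j -> j \in A -> i \notin A -> tperm i j @: A \in F.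

Definition up_closed n (F : {set {set 'I_n}}) :=
  forall A B : {set 'I_n}, A \in F -> A \subset B -> B \in F.

Lemma tperm_imsetK n (i j : 'I_n) (A : {set 'I_n}) :
  tperm i j @: (tperm i j @: A) = A.
Proof.
rewrite -imset_comp -[RHS]imset_id.
by apply: eq_imset => x /=; rewrite tpermK.
Qed.

Lemma mem_tperm_imset n (i j : 'I_n) (A : {set 'I_n}) x :
  (x \in tperm i j @: A) = (tperm i j x \in A).
Proof. by rewrite -{1}[x](tpermK i j) mem_imset //; apply: perm_inj. Qed.

Lemma up_closure_matching n (F : {set {set 'I_n}}) s :
  ~~ has_matching F s ->
  ~~ has_matching [set B : {set 'I_n} | [exists A in F, A \subset B]] s.
Proof.
apply: contra => /has_matchingP[B [BF dB]].
have /fin_all_exists2[A AF AB] i : exists2 A, A \in F & A \subset B i.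
  by have := BF i; rewrite inE => /exists_inP.
apply: (has_matching_fin (A := A)); rewrite ?card_ord // => i j /eqP ij.
by apply: disjointWl (AB i) _; apply: disjointWr (AB j) _; rewrite -setI_eq0 dB.
Qed.

Section Shift.

Variables (n : nat) (F : {set {set 'I_n}}) (i j : 'I_n).

Let moves (A : {set 'I_n}) :=
  [&& j \in A, i \notin A & tperm i j @: A \notin F].

Definition shift (A : {set 'I_n}) := if moves A then tperm i j @: A else A.

Lemma shift_inj : {in F &, injective shift}.
Proof.
move=> A B AF BF; rewrite /shift; case: ifP => mA; case: ifP => mB //.
- by move/(congr1 (fun S : {set 'I_n} => tperm i j @: S)); rewrite !tperm_imsetK.
- by move=> AB; case/and3P: mA => _ _; rewrite AB BF.
by move=> AB; case/and3P: mB => _ _; rewrite -AB AF.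
Qed.

(** If some [B k0] is not in [F], it was moved and contains [i], and no other [B k] does. Swapping
    [i] and [j] in all the sets then gives disjoint members of [F]: [B k0] returns to its origin, a
    set containing [j] but not [i] was not moved because its swap is in [F], and the remaining sets
    do not change. *)
Lemma shift_matching s :
  ~~ has_matching F s -> ~~ has_matching (shift @: F) s.
Proof.
apply: contra => /has_matchingP[B [BF dB]].
have inF k : i \notin B k -> B k \in F /\ (j \in B k -> tperm i j @: B k \in F).
  have /imsetP[A AF ->] := BF k; rewrite /shift.
  case mA: (moves A) => iB; last first.
    split=> // jA; move: mA; rewrite /moves jA iB /=.
    by move/negbFE.
  by case/and3P: mA iB => jA _ _; rewrite mem_tperm_imset tpermL jA.
case: (pickP [pred k | B k \notin F]) => [k0 /= k0F|allF]; last first.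
  apply: (has_matching_fin (A := B)); rewrite ?card_ord //.
    by move=> k; have /negbFE := allF k.
  by move=> k l /eqP kl; rewrite -setI_eq0 dB.
have ik0 : i \in B k0.
  by apply: contraNT k0F => /inF[].
have other k : k != k0 -> i \notin B k.
  move=> kk0; apply/negP => ik; have /eqP := kk0.
  by move/dB => /setP/(_ i); rewrite !inE ik ik0.
apply: (has_matching_fin (A := fun k => tperm i j @: B k)); rewrite ?card_ord //.
  move=> k; case: (eqVneq k k0) => [->|/other iB].
    have /imsetP[A AF BA] := BF k0; move: k0F; rewrite BA /shift.
    by case: ifP => [_ _|_]; rewrite ?tperm_imsetK ?AF.
  have [BkF BkT] := inF k iB; case jB: (j \in B k); first exact: BkT.
  suff -> : tperm i j @: B k = B k by [].
  apply/setP => x; rewrite mem_tperm_imset; case: tpermP => [->|->|//].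
    by rewrite jB (negbTE iB).
  by rewrite jB (negbTE iB).
move=> k l /eqP kl; apply: disjoint_imset; first exact: perm_inj.
by rewrite -setI_eq0 dB.
Qed.

End Shift.

Section Extremal.

Variables n s : nat.

Definition potential (F : {set {set 'I_n}}) := \sum_(A in F) \sum_(x in A) val x.

(* Among the families without [s] disjoint members, take one of maximal size and,
   subject to that, of minimal potential. *)
Lemma exists_shifted (F : {set {set 'I_n}}) : ~~ has_matching F s ->
  exists G : {set {set 'I_n}},
    [/\ ~~ has_matching G s, #|F| <= #|G|, shifted G & up_closed G].
Proof.
move=> Fs; pose K := potential setT.
have potK G : potential G <= K.
  rewrite /potential big_mkcond /K /potential [leqRHS]big_mkcond.
  by apply: leq_sum => A _; rewrite inE; case: ifP.
(* As [K] bounds every potential, [mu] orders families by size first and by decreasing potential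
   second. *)
pose mu (G : {set {set 'I_n}}) := #|G| * K.+1 + (K - potential G).
pose G := [arg max_(G > F | ~~ has_matching G s) mu G].
have [Gs Gmax] : ~~ has_matching G s /\
    forall H, ~~ has_matching H s -> mu H <= mu G.
  by rewrite /G; case: arg_maxnP.
have card_max (H : {set {set 'I_n}}) : ~~ has_matching H s -> #|H| <= #|G|.
  move=> /Gmax; rewrite /mu => leHG; rewrite leqNgt; apply: contraTN leHG => GH.
  rewrite -ltnNge; apply: (@leq_trans (#|G|.+1 * K.+1)).
    by rewrite mulSn; have := potK G; lia.
  by apply: leq_trans (leq_addr _ _); rewrite leq_mul2r GH orbT.
have pot_min (H : {set {set 'I_n}}) :
    ~~ has_matching H s -> #|H| = #|G| -> potential G <= potential H.
  move=> Hs eHG; have := Gmax H Hs; rewrite /mu eHG leq_add2l.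
  by have := potK G; have := potK H; lia.
exists G; split=> //; first exact: card_max.
  move=> A i j AG ij jA iA; apply/negPn/negP => tA.
  have inj := @shift_inj n G i j.
  have := pot_min _ (@shift_matching n G i j s Gs) (card_in_imset inj).
  rewrite leqNgt => /negP; apply.
  rewrite /potential big_imset //=.
  have le_sum (B : {set 'I_n}) : j \in B -> i \notin B ->
      \sum_(x in tperm i j @: B) val x < \sum_(x in B) val x.
    move=> jB iB; rewrite big_imset /=; last by move=> x y _ _; apply: perm_inj.
    rewrite (bigD1 j) // [ltnRHS](bigD1 j) //= tpermR.
    rewrite -addSn leq_add //; apply: leq_sum => x /andP[xB xj].
    by rewrite tpermD // eq_sym //; apply: contraNneq iB => <-.
  rewrite (bigD1 A) // [ltnRHS](bigD1 A) //= -addSn leq_add //.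
    by rewrite /shift jA iA tA le_sum.
  apply: leq_sum => B _; rewrite /shift; case: ifP => // /and3P[jB iB _].
  exact/ltnW/le_sum.
(* By maximality the upward closure of [G] is no larger than [G], hence equal to it. *)
move=> A B AG AB; have := up_closure_matching Gs.
set H := [set B : {set 'I_n} | _] => Hs.
have GH : G \subset H.
  by apply/subsetP => S SG; rewrite inE; apply/exists_inP; exists S.
have /eqP -> : G == H by rewrite eqEcard GH card_max.
by rewrite inE; apply/exists_inP; exists A.
Qed.

End Extremal.

Section Shadow.

Variables (N r m : nat) (G : {set {set 'I_N}}).
Hypotheses (G_shift : shifted G) (G_unif : forall A, A \in G -> #|A| = m).
Hypotheses (m_gt0 : 0 < m) (G_matching : ~~ has_matching G r.+1).

Definition head (x : nat) : {set 'I_N} := blk N 0 x.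

Lemma mem_head x (y : 'I_N) : (y \in head x) = (y < x).
Proof. by rewrite inE add0n. Qed.

(** Induction on |A \ B|: the least point [j] of A \ B is exchanged for the least point [i] of B \
    A. Domination forces [i < j], so the exchange is a shift, and it survives the exchange. *)
Lemma shifted_dominated (A B : {set 'I_N}) : A \in G -> #|B| = #|A| ->
  (forall x, #|A :&: head x| <= #|B :&: head x|) -> B \in G.
Proof.
have [k] := ubnP #|A :\: B|; elim: k => // k IHk in A *.
rewrite ltnS => ABk AG cBA dom.
have cAB := cardsID B A; have cBA' := cardsID A B; rewrite setIC in cBA'.
have [AB0|AB_gt0] := posnP #|A :\: B|.
  suff -> : B = A by [].
  apply/esym/eqP; rewrite eqEcard cBA leqnn andbT -setD_eq0.
  by rewrite -cards_eq0 AB0.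
have /card_gt0P[j0 j0P] := AB_gt0.
have /card_gt0P[i0 i0P] : 0 < #|B :\: A| by lia.
pose j := [arg min_(x < j0 in A :\: B) val x].
pose i := [arg min_(x < i0 in B :\: A) val x].
have [jAB j_min] : j \in A :\: B /\ forall x, x \in A :\: B -> j <= x.
  by rewrite /j; case: arg_minnP.
have [iBA i_min] : i \in B :\: A /\ forall x, x \in B :\: A -> i <= x.
  by rewrite /i; case: arg_minnP.
clearbody i j; move: (jAB) (iBA); rewrite !inE => /andP[jB jA] /andP[iA iB].
have ij_neq : i != j by apply: contraNneq iA => ->.
have ij : i < j.
  rewrite ltn_neqAle ij_neq leqNgt; apply/negP => ji.
  have := dom j.+1; rewrite leqNgt => /negP; apply; apply: proper_card.
  apply/properP; split.
    apply/subsetP => x; rewrite !in_setI !mem_head ltnS => /andP[xB xj].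
    rewrite xj andbT; apply/negPn/negP => xA.
    have : i <= x by apply: i_min; rewrite !inE xB xA.
    by rewrite leqNgt (leq_ltn_trans xj ji).
  by exists j; rewrite !in_setI mem_head ?jA ?(negbTE jB) //=.
have tA x : (x \in tperm i j @: A) = (x == i) || (x \in A) && (x != j).
  rewrite mem_tperm_imset; case: tpermP => [->|->|/eqP xi /eqP xj].
  - by rewrite jA eqxx.
  - by rewrite (negbTE iA) eqxx andbF orbF eq_sym (negbTE ij_neq).
  - by rewrite (negbTE xi) xj andbT.
apply: (IHk (tperm i j @: A)).
- apply: leq_trans ABk; apply: proper_card; apply/properP; split.
    apply/subsetP => x; rewrite !inE tA => /andP[xB].
    by case: eqP xB => [->|_ xB /andP[->]]; rewrite ?iB ?xB.
  by exists j; rewrite !inE ?tA ?jA ?jB // eqxx andbF orbF eq_sym (negbTE ij_neq).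
- exact: G_shift.
- by rewrite card_imset //; apply: perm_inj.
(* Up to [i] the new set has no new points. Between [i] and [j] all points of [A] lie in [B] by the
   choice of [j], and so does [i]. Beyond [j] the exchange does not change the count. *)
move=> x; have [xi|ix] := leqP x i.
  apply: leq_trans (dom x); apply/subset_leq_card/subsetP => y.
  rewrite !in_setI !mem_head tA => /andP[+ yx]; rewrite yx andbT.
  by case: eqP => [yi|_ /andP[]//]; move: yx; rewrite yi ltnNge xi.
have [xj|jx] := leqP x j.
  apply: (@leq_trans #|i |: (A :&: head x)|).
    apply/subset_leq_card/subsetP => y.
    rewrite in_setU1 !in_setI !mem_head tA => /andP[+ ->].
    by rewrite andbT; case: eqP => //= _ /andP[].
  apply: subset_leq_card; apply/subsetP => y; rewrite in_setU1 !in_setI !mem_head.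
  case/orP=> [/eqP->|/andP[yA yx]]; first by rewrite iB ix.
  rewrite yx andbT; apply/negPn/negP => yB.
  have : j <= y by apply: j_min; rewrite !inE yA yB.
  by rewrite leqNgt (leq_trans yx xj).
apply: leq_trans (dom x); rewrite -(card_imset (A :&: head x) (@perm_inj _ (tperm i j))).
apply/subset_leq_card/subsetP => y; rewrite in_setI mem_tperm_imset mem_tperm_imset.
rewrite in_setI mem_head => /andP[-> yx]; rewrite mem_head /=.
by case: tpermP => // _.
Qed.

Lemma head_card x : #|head x| <= x.
Proof.
have [xN|Nx] := leqP x N; first by rewrite card_blk.
by apply: leq_trans (ltnW Nx); rewrite -[leqRHS]card_ord max_card.
Qed.

Lemma head_le (A : {set 'I_N}) x y : x <= y -> #|A :&: head x| <= #|A :&: head y|.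
Proof.
move=> xy; apply/subset_leq_card/setIS/subsetP => z; rewrite !mem_head.
by move=> zx; apply: leq_trans xy.
Qed.

(* If there were no such [k], the k-th smallest element of [A], counted from 0,
   would be at least [(r + 1) k + r], and the [r + 1] disjoint sets
   [{(r + 1) k + t | k < m}], [t <= r], would all lie below [A] in the shifting
   order. *)
Lemma crowded_head (A : {set 'I_N}) : A \in G ->
  exists2 k, 0 < k <= m & k <= #|A :&: head (r.+1 * k - 1)|.
Proof.
move=> AG; have cA := G_unif AG.
case: (pickP [pred k : 'I_m | k.+1 <= #|A :&: head (r.+1 * k.+1 - 1)|]) => [k kA|none].
  by exists k.+1; [apply: ltn_ord | exact: kA].
have few k : k < m -> #|A :&: head (r.+1 * k.+1 - 1)| <= k.
  by move=> km; have := none (Ordinal km); rewrite /= ltnNge => /negbFE.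
have rmN : r.+1 * m <= N.
  rewrite leqNgt; apply/negP => Nrm; have := few m.-1.
  rewrite prednK // leqnn => /(_ isT).
  rewrite (setIidPl _) ?cA; first by rewrite leqNgt prednK ?leqnn.
  apply/subsetP => x _; rewrite mem_head; have := ltn_ord x; lia.
have lt_pt (t : 'I_r.+1) (k : 'I_m) : r.+1 * k + t < N.
  have : r.+1 * k.+1 <= r.+1 * m by rewrite leq_mul2l ltn_ord orbT.
  by rewrite mulnS; have := ltn_ord t; lia.
pose pt t k := Ordinal (lt_pt t k).
have pt_inj t t' k k' : pt t k = pt t' k' -> t = t' /\ k = k'.
  move/(congr1 val) => /= e; split; apply: val_inj => /=.
    have := congr1 (modn^~ r.+1) e.
    by rewrite ![r.+1 * _]mulnC !modnMDl !modn_small.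
  have := congr1 (divn^~ r.+1) e.
  by rewrite ![r.+1 * _]mulnC !divnMDl // !divn_small // !addn0.
case/negP: G_matching.
apply: (has_matching_fin (A := fun t : 'I_r.+1 => pt t @: setT)).
- by rewrite card_ord.
- move=> t; apply: (shifted_dominated AG).
    rewrite card_imset ?cardsT ?card_ord //; last by move=> k k' /pt_inj[].
  move=> x; pose c := #|A :&: head x|; rewrite -/c.
  have cm : c <= m by rewrite -cA /c subset_leq_card // subsetIl.
  have wi : injective (fun k : 'I_c => pt t (widen_ord cm k)).
    by move=> k k' /pt_inj[_] /(congr1 val) /= /val_inj.
  rewrite -[leqLHS]card_ord -cardsT -(card_imset _ wi).
  apply/subset_leq_card/subsetP => y /imsetP[k _ ->].
  rewrite in_setI imset_f //= mem_head /=.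
  have c0 : 0 < c by have := ltn_ord k; lia.
  have cx : r.+1 * c - 1 < x.
    rewrite ltnNge; apply/negP => xc; have := few c.-1.
    rewrite prednK // => /(_ cm); have := head_le A xc; rewrite -/c; lia.
  have : r.+1 * k.+1 <= r.+1 * c by rewrite leq_mul2l ltn_ord orbT.
  by rewrite mulnS; have := ltn_ord t; lia.
move=> t t' tt'; apply: disjoint_of => x /imsetP[k _ ->] /imsetP[k' _] /pt_inj[e _].
by rewrite e eqxx in tt'.
Qed.

Definition shadow : {set {set 'I_N}} :=
  [set B | [exists A in G, [exists x in A, B == A :\ x]]].

Let c (A : {set 'I_N}) k := #|A :&: head (r.+1 * k - 1)|.

(** Members are sorted by the last [k] at which they are crowded in the sense of [crowded_head];
    [Slast] is the same condition for a set that has lost one of the points counted. Taking the last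
    [k] makes the classes [Slast k] disjoint. *)
Let Glast (k : 'I_m.+1) := [set A in G | [&& 0 < k, k <= c A k &
  [forall k' : 'I_m.+1, (k < k') ==> (c A k' < k')]]].

Let Slast (k : 'I_m.+1) := [set B in shadow | [&& 0 < k, k <= (c B k).+1 &
  [forall k' : 'I_m.+1, (k < k') ==> ((c B k').+1 < k')]]].

Lemma Slast_disjoint k k' : k != k' -> [disjoint Slast k & Slast k'].
Proof.
wlog kk' : k k' / k < k'.
  move=> W ne; have : (k < k') || (k' < k) by rewrite -neq_ltn.
  by case/orP=> ?; [apply: W | rewrite disjoint_sym; apply: W; rewrite // eq_sym].
move=> _; apply: disjoint_of => B; rewrite !inE.
move=> /andP[_ /and3P[_ _ /forallP/(_ k')]] + /andP[_ /and3P[_ + _]].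
by rewrite kk' /=; lia.
Qed.

(* Removing from [A] a point of its crowded head [head (r.+1 * k - 1)] keeps [k]
   recognizable, and a set of [Slast k] arises from at most [r * k] such pairs. *)
Lemma card_Glast k : #|Glast k| <= r * #|Slast k|.
Proof.
have [k0|k_gt0] := posnP k.
  rewrite (_ : #|Glast k| = 0) //; apply/eqP; rewrite cards_eq0 -subset0.
  by apply/subsetP => A; rewrite !inE k0 /= andbF.
rewrite -(leq_pmul2l k_gt0); set H := head (r.+1 * k - 1).
have subH (k' : nat) : k < k' -> H \subset head (r.+1 * k' - 1).
  move=> kk'; apply/subsetP => x; rewrite !mem_head => xk; apply: leq_trans xk _.
  by apply: leq_sub2r; rewrite leq_mul2l ltnW ?orbT.
have removed A x : A \in Glast k -> x \in A -> x \in H -> A :\ x \in Slast k.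
  rewrite inE => /andP[AG /and3P[_ kA /forallP lastA]] xA xH; rewrite inE.
  have cD k' : x \in head (r.+1 * k' - 1) -> (c (A :\ x) k').+1 = c A k'.
    move=> xk'; rewrite /c [in RHS](cardsD1 x) in_setI xA xk' add1n; congr _.+1.
    by apply: eq_card => y; rewrite !inE; case: (y == x).
  apply/andP; split.
    by rewrite inE; apply/exists_inP; exists A => //; apply/exists_inP; exists x.
  rewrite k_gt0 cD //= kA; apply/forallP => k'; apply/implyP => kk'.
  rewrite cD; last exact: subsetP (subH _ kk') _ xH.
  exact: implyP (lastA k') kk'.
pose T := [set p : {set 'I_N} * 'I_N | (p.1 \in Glast k) && (p.2 \in p.1 :&: H)].
pose U := [set p : {set 'I_N} * 'I_N | (p.1 \in Slast k) && (p.2 \in H :\: p.1)].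
have cardP (P : {set {set 'I_N}}) (Q : {set 'I_N} -> {set 'I_N}) :
    #|[set p : {set 'I_N} * 'I_N | (p.1 \in P) && (p.2 \in Q p.1)]| =
    \sum_(A in P) #|Q A|.
  rewrite -sum1dep_card -(pair_big_dep (mem P) (fun A x => x \in Q A) (fun _ _ => 1)) /=.
  by apply: eq_bigr => A _; rewrite sum1_card.
have lowT : k * #|Glast k| <= #|T|.
  rewrite /T (cardP _ (fun A => A :&: H)) mulnC -sum_nat_const; apply: leq_sum => A.
  by rewrite inE => /andP[_ /and3P[_ kA _]].
have upU : #|U| <= k * (r * #|Slast k|).
  rewrite /U (cardP _ (fun A => H :\: A)) mulnA mulnC -sum_nat_const.
  apply: leq_sum => B; rewrite inE => /andP[_ /and3P[_ kB _]].
  have := cardsID B H; rewrite setIC -/(c B k).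
  have : #|H| <= r.+1 * k - 1 := head_card _.
  by move: kB; rewrite -/H /c mulSn mulnC; lia.
apply: leq_trans lowT (leq_trans _ upU).
have inj : {in T &, injective (fun p : {set 'I_N} * 'I_N => (p.1 :\ p.2, p.2))}.
  move=> [A x] [B y]; rewrite !inE /= => /andP[_ /andP[xA _]] /andP[_ /andP[yB _]].
  move=> [e exy]; rewrite -exy in e yB *.
  by rewrite -(setD1K xA) -(setD1K yB) e.
rewrite -(card_in_imset inj); apply/subset_leq_card/subsetP => p /imsetP[[A x]].
rewrite in_set /= => /andP[AG]; rewrite in_setI => /andP[xA xH] -> /=.
have := removed A x; rewrite AG => /(_ isT xA xH) /=.
by move=> AS; rewrite in_set /= AS in_setD in_setD1 eqxx xH.
Qed.

Lemma shadow_bound : #|G| <= r * #|shadow|.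
Proof.
apply: (@leq_trans (\sum_k #|Glast k|)).
  have sub : G \subset \bigcup_k Glast k.
    apply/subsetP => A AG; have [k0 /andP[k0_gt0 k0m] k0A] := crowded_head AG.
    pose P k := (k <= m) && (k <= c A k).
    have exP : exists k, P k by exists k0; rewrite /P k0m.
    have ubP k : P k -> k <= m by case/andP.
    case: (ex_maxnP exP ubP) => k /andP[km kA] k_max.
    have km' : k < m.+1 by [].
    apply/bigcupP; exists (Ordinal km') => //; rewrite inE AG /= kA.
    rewrite (leq_trans k0_gt0) /=; last by apply: k_max; rewrite /P k0m.
    apply/forallP => k'; apply/implyP => kk'; rewrite ltnNge; apply/negP => k'A.
    have := k_max k'; rewrite /P -ltnS ltn_ord k'A => /(_ isT).
    by rewrite leqNgt kk'.
  exact: leq_trans (subset_leq_card sub) (leq_card_bigcup _ _).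
apply: (@leq_trans (\sum_k r * #|Slast k|)).
  by apply: leq_sum => k _; apply: card_Glast.
rewrite -big_distrr leq_mul2l /=; apply/orP; right.
apply: leq_trans (leq_sum_cardI shadow Slast_disjoint).
apply: leq_sum => k _; rewrite (setIidPl _) //.
by apply/subsetP => B; rewrite inE => /andP[].
Qed.

End Shadow.

(** * Shifted families of small total deficit *)

(** Representatives are chosen from the last index downwards: when [i] is reached, [l - i - 1]
    elements are in use and [X i] has at least [l - i]. *)
Lemma greedy_sdr l (S : finType) (X : 'I_l -> {set S}) :
  (forall i : 'I_l, l - i <= #|X i|) ->
  exists2 phi : 'I_l -> S, injective phi & forall i, phi i \in X i.
Proof.
move=> cX.
suff H k : k <= l -> exists2 phi : 'I_l -> S,
    {in blk l (l - k) k &, injective phi} &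
    (forall i, i \in blk l (l - k) k -> phi i \in X i).
  have [phi phi_inj phiX] := H l (leqnn l).
  have all_in (i : 'I_l) : i \in blk l (l - l) l by rewrite mem_blk; have := ltn_ord i; lia.
  by exists phi => [i j /phi_inj|i]; [apply | apply: phiX].
elim: k => [_|k IHk kl].
  have X0 (i : 'I_l) : exists x, x \in X i.
    by apply/card_gt0P; apply: leq_trans (cX i); rewrite subn_gt0.
  have [phi phiX] : {phi : 'I_l -> S | forall i, phi i \in X i}.
    by exists (fun i => xchoose (X0 i)) => i; apply: xchooseP.
  by exists phi => // i j; rewrite mem_blk; lia.
have [phi phi_inj phiX] := IHk (ltnW kl).
have i0P : l - k.+1 < l by lia.
pose i0 := Ordinal i0P; pose U := phi @: blk l (l - k) k.
have [y yX yU] : exists2 y, y \in X i0 & y \notin U.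
  apply/subsetPn/negP => /subset_leq_card; rewrite leqNgt => /negP; apply.
  apply: leq_trans (cX i0); rewrite /= subKn // ltnS.
  by apply: leq_trans (leq_imset_card _ _) _; rewrite card_blk //; lia.
have blkE (i : 'I_l) : i \in blk l (l - k.+1) k.+1 -> i != i0 -> i \in blk l (l - k) k.
  by rewrite !mem_blk -val_eqE /=; lia.
exists (fun i => if i == i0 then y else phi i) => [i j iB jB|i iB]; last first.
  by case: eqVneq => [->//|/(blkE _ iB)/phiX].
case: (eqVneq i i0) => [->|/(blkE _ iB) {}iB];
  case: (eqVneq j i0) => [->|/(blkE _ jB) {}jB] //.
- by move=> yj; rewrite yj imset_f in yU.
- by move=> yi; rewrite -yi imset_f in yU.
- exact: phi_inj.
Qed.

Section Trace.

Variables (n N l : nat).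
Hypothesis nE : n = l + N.
Implicit Types (F : {set {set 'I_n}}) (I : {set 'I_n}) (X : {set 'I_N}).

Lemma emb_lt (x : 'I_N) : l + x < n.
Proof. by rewrite nE ltn_add2l. Qed.

Definition emb (x : 'I_N) : 'I_n := Ordinal (emb_lt x).

Lemma emb_inj : injective emb.
Proof. by move=> x y /(congr1 val) /= /addnI /val_inj. Qed.

Definition trace F I : {set {set 'I_N}} :=
  [set X : {set 'I_N} | I :|: emb @: X \in F].

Lemma disjoint_emb I X : I \subset blk n 0 l -> [disjoint I & emb @: X].
Proof.
move=> Il; apply: disjoint_of => y yI /imsetP[x _ yx].
have := subsetP Il y yI; rewrite inE yx /=; lia.
Qed.

Lemma card_trace_set I X :
  I \subset blk n 0 l -> #|I :|: emb @: X| = #|I| + #|X|.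
Proof.
move=> Il; rewrite cardsU (disjoint_setI0 (disjoint_emb X Il)) cards0 subn0.
by rewrite card_imset //; apply: emb_inj.
Qed.

Lemma card_trace F I h : I \subset blk n 0 l ->
  #|[set A in F | (A :&: blk n 0 l == I) && (#|A| == #|I| + h)]| =
  level (trace F I) h.
Proof.
move=> Il; pose f X := I :|: emb @: X.
have traceE X : f X :\: blk n 0 l = emb @: X.
  apply/setP => y; rewrite !inE add0n /=.
  apply/andP/imsetP => [[yl /orP[yI|/imsetP[x xX ->]]]|[x xX ->]].
  - by have := subsetP Il y yI; rewrite inE add0n (negbTE yl).
  - by exists x.
  by rewrite /= imset_f ?orbT // -leqNgt leq_addr.
have f_inj : injective f.
  move=> X Y e; apply: (imset_inj emb_inj).
  by rewrite -!traceE e.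
rewrite /level -[RHS](card_imset _ f_inj); apply: eq_card => A; rewrite inE.
apply/and3P/imsetP => [[AF /eqP AI /eqP cA]|[X + ->]].
  have fA : f (emb @^-1: A) = A.
    apply/setP => y; rewrite /f -AI !inE add0n /=; apply/orP/idP.
      by case=> [/andP[]//|/imsetP[x + ->]]; rewrite inE.
    move=> yA; have [yl|ly] := ltnP y l; [by left; rewrite yA | right].
    have yN : y - l < N by have := ltn_ord y; move: (val y) ly; rewrite nE /=; lia.
    have yE : emb (Ordinal yN) = y by apply: val_inj; rewrite /= subnKC.
    by apply/imsetP; exists (Ordinal yN); rewrite ?inE yE.
  exists (emb @^-1: A) => //; rewrite !inE -/(f _) fA AF /=.
  by rewrite -(eqn_add2l #|I|) -card_trace_set // -/(f _) fA cA.
rewrite !inE => /andP[fF /eqP cX]; split=> //; last by rewrite card_trace_set // cX.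
apply/eqP/setP => y; rewrite !inE add0n /=; apply/andP/idP.
  case=> /orP[//|/imsetP[x _ ->]] /=.
  by rewrite ltnNge leq_addr.
by move=> yI; have := subsetP Il y yI; rewrite inE add0n yI.
Qed.

End Trace.

Lemma tperm_setU1 n (i j : 'I_n) (Y : {set 'I_n}) :
  i \notin Y -> j \notin Y -> tperm i j @: (j |: Y) = i |: Y.
Proof.
move=> iY jY; apply/setP => x; rewrite mem_tperm_imset !in_setU1.
case: tpermP => [->|->|/eqP xi /eqP xj].
- by rewrite !eqxx.
- by rewrite (negbTE iY) (negbTE jY) !orbF eq_sym.
by rewrite (negbTE xi) (negbTE xj).
Qed.

Section Light.

Variables (n N s l b : nat) (F : {set {set 'I_n}}).
Let m := b.+1.
Hypotheses (nN : n = l + N) (l_gt0 : 0 < l) (ls : l < s) (sbN : s * b <= N).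
Hypotheses (F_shift : shifted F) (F_up : up_closed F).
Hypothesis F_light : ~ heavy F m l.

Let le_ln : l <= n. Proof. by rewrite nN leq_addr. Qed.
Let lt_last : l.-1 < l. Proof. by rewrite prednK. Qed.

Let el (i : 'I_l) : 'I_n := widen_ord le_ln i.
Let last : 'I_l := Ordinal lt_last.
Let tr0 := trace nN F set0.
Let tr (i : 'I_l) := trace nN F [set el i].
Let H j := blk N (j * b) b.

Let el_inj : injective el.
Proof. by move=> i j /(congr1 val) /= /val_inj. Qed.

Let el_blk i : [set el i] \subset blk n 0 l.
Proof. by rewrite sub1set inE /= add0n. Qed.

(** The form in which [F_light] is used: disjoint sets [I i] among the first [l] points and disjoint
    sets [Y i] behind them are glued to disjoint members. *)
Lemma light_traces (J : {set 'I_l}) (I : 'I_l -> {set 'I_n})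
    (Y : 'I_l -> {set 'I_N}) :
  (forall i, i \in J -> I i \subset blk n 0 l) ->
  (forall i j, i \in J -> j \in J -> i != j -> [disjoint I i & I j]) ->
  (forall i j, i \in J -> j \in J -> i != j -> [disjoint Y i & Y j]) ->
  (forall i, i \in J -> Y i \in trace nN F (I i)) ->
  \sum_(i in J) (#|I i| + #|Y i|) + l <= #|J| * m.+1 -> False.
Proof.
move=> Il dI dY YF sumJ; apply: F_light.
exists J, (fun i => I i :|: emb nN @: Y i); split.
- by move=> i /YF; rewrite inE.
- move=> i j iJ jJ ij.
  have eI k y : k \in J -> y \in I k ->
      y \in emb nN @: Y i :|: emb nN @: Y j -> False.
    move=> kJ yI; rewrite -imsetU => yY.
    exact: disjoint_false (disjoint_emb nN _ (Il k kJ)) yI yY.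
  apply: disjoint_of => y; rewrite !in_setU => /orP[yi|yi] /orP[yj|yj].
  + exact: disjoint_false (dI _ _ iJ jJ ij) yi yj.
  + by apply: (eI i y); rewrite // in_setU yj orbT.
  + by apply: (eI j y); rewrite // in_setU yi.
  + exact: disjoint_false (disjoint_imset (@emb_inj _ _ _ nN) (dY _ _ iJ jJ ij)) yi yj.
apply: leq_trans sumJ; rewrite leq_add2r; apply: leq_sum => i iJ.
by rewrite card_trace_set ?Il.
Qed.

Let disjoint_H (t : {perm 'I_N}) (j j' : nat) : j != j' -> [disjoint t @: H j & t @: H j'].
Proof.
move=> jj'; apply: disjoint_imset; first exact: perm_inj.
have : j < j' \/ j' < j by apply/orP; rewrite -neq_ltn.
case=> /(leq_mulS_lt b) lt; last rewrite disjoint_sym; exact: disjoint_blk.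
Qed.

Let card_tH (t : {perm 'I_N}) j : j < s -> #|t @: H j| = b.
Proof.
move=> js; rewrite card_imset ?card_blk //; last exact: perm_inj.
exact: leq_trans (leq_mulS_lt b js) sbN.
Qed.

Lemma trace_nested (i j : 'I_l) : i <= j -> tr j \subset tr i.
Proof.
rewrite leq_eqVlt => /orP[/eqP/val_inj->//|ij]; apply/subsetP => X; rewrite !inE => XF.
have notX k : el k \notin emb nN @: X.
  by apply/negP; apply: disjoint_false (disjoint_emb nN X (el_blk k)) _; rewrite inE.
rewrite -(tperm_setU1 (notX i) (notX j)); apply: F_shift => //; rewrite !inE ?eqxx //.
by rewrite negb_or notX andbT; apply: contraTneq ij => /el_inj->; rewrite ltnn.
Qed.

(* Among [s] disjoint sets of size [b = m - 1], let [X i] collect those that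
   extend the point [i] to a member.  The [X i] decrease with [i], and a system of
   distinct representatives would have total deficit [l]. *)
Lemma mean_last :
  ((s - l + 1)%:R * dens (tr last) b + \sum_(i | i != last) dens (tr i) b
   <= (l - 1)%:R)%R.
Proof.
pose X (t : {perm 'I_N}) (i : 'I_l) := [set j : 'I_s | t @: H j \in tr i].
have bound t : (s - l + 1) * #|X t last| + \sum_(i | i != last) #|X t i| <= (l - 1) * s.
  have nested (i j : 'I_l) : i <= j -> #|X t j| <= #|X t i|.
    move=> ij; apply/subset_leq_card/subsetP => x.
    rewrite [x \in X t j]in_set [x \in X t i]in_set.
    exact: subsetP (trace_nested ij) _.
  have [i0 i0P] : exists i0 : 'I_l, #|X t i0| < l - i0.
    case: (pickP [pred i : 'I_l | #|X t i| < l - i]) => [i ?|no]; first by exists i.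
    have [|phi phi_inj phiX] := @greedy_sdr l 'I_s (X t).
      by move=> i; have := no i; rewrite /= ltnNge => /negbFE.
    exfalso; apply: (@light_traces setT (fun i => [set el i]) (fun i => t @: H (phi i))).
    - by move=> i _; apply: el_blk.
    - by move=> i j _ _ ij; rewrite disjoints1 inE; apply: contra ij => /eqP/el_inj->.
    - move=> i j _ _ ij; apply: disjoint_H; apply: contra ij => /eqP/val_inj/phi_inj.
      by move->.
    - by move=> i _; have := phiX i; rewrite inE.
    rewrite (eq_bigr (fun _ => m)) => [|i _]; last by rewrite cards1 card_tH.
    by rewrite sum_nat_const cardsT card_ord mulnS addnC.
  (* The sets before [i0] have at most [s] elements each and, by nesting, those from [i0] on at most
     [p]. Then (s - l + 1) p + i0 s + p^2 <= (i0 + p) s = (l - 1) s because p <= l - 1. *)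
  pose p := l.-1 - i0.
  have Xp (i : 'I_l) : i0 <= i -> #|X t i| <= p.
    move=> /nested le_i; apply: leq_trans le_i _; rewrite /p -ltnS.
    by apply: leq_trans i0P _; have := ltn_ord i0; lia.
  have Xs i : #|X t i| <= s by rewrite -[leqRHS]card_ord max_card.
  have le_last : i0 <= last by rewrite -ltnS /= prednK.
  have sumX : \sum_(i | i != last) #|X t i| <= i0 * s + p * p.
    rewrite (bigID (fun i : 'I_l => i < i0)) /= leq_add //.
      apply: (@leq_trans (\sum_(i < l | i < i0) s)).
        rewrite [leqRHS]big_mkcond [leqLHS]big_mkcond; apply: leq_sum => i _.
        by case: (i < i0); rewrite ?andbF // andbT; case: ifP.
      rewrite sum_nat_const leq_mul2r; apply/orP; right.
      have := card_blk (n := l) (a := 0) (h := i0) (ltnW (ltn_ord i0)) => {2}<-.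
      by apply/subset_leq_card/subsetP => i; rewrite !inE unfold_in.
    apply: (@leq_trans (\sum_(i < l | i \in blk l i0 p) p)).
      rewrite [leqRHS]big_mkcond [leqLHS]big_mkcond; apply: leq_sum => i _.
      case: ifP => // /andP[il ii0]; rewrite mem_blk.
      rewrite ifT ?Xp // 1?leqNgt // ii0 /=; move: il; rewrite -val_eqE /= /p.
      by have := ltn_ord i; lia.
    rewrite sum_nat_const card_blk // /p; have := ltn_ord i0; lia.
  apply: (@leq_trans ((s - l + 1) * p + (i0 * s + p * p))).
    by rewrite leq_add // leq_mul2l Xp ?orbT.
  have -> : l - 1 = i0 + p by rewrite /p subn1 subnKC.
  rewrite [(i0 + p) * s]mulnDl addnCA leq_add2l -mulnDl mulnC leq_mul2l.
  by apply/orP; right; rewrite /p; lia.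
have := ler_mean bound; rewrite mean_cst meanD meanZ.
have meanX i : (mean (fun t => #|X t i|) = s%:R * dens (tr i) b)%R.
  under eq_mean => t.
    rewrite (_ : #|X t i| = \sum_(j < s) (t @: H j \in tr i)); first over.
    by rewrite -big_mkcond sum1_card; apply: eq_card => j; rewrite [LHS]in_set.
  rewrite mean_sum.
  under eq_bigr => j _.
    rewrite mean_mem card_blk; last exact: leq_trans (leq_mulS_lt b (ltn_ord j)) sbN.
    over.
  by rewrite sumr_const card_ord mulr_natl.
rewrite meanX (_ : mean _ = (\sum_(i | i != last) s%:R * dens (tr i) b)%R); last first.
  rewrite [in LHS](eq_mean (g := fun t => \sum_i (i != last) * #|X t i|)); last first.
    by move=> t; rewrite big_mkcond; apply: eq_bigr => i _; case: (_ != _); rewrite ?mul1n.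
  rewrite mean_sum [RHS]big_mkcond; apply: eq_bigr => i _; rewrite meanZ meanX.
  by case: (_ != _); rewrite ?mul1r ?mul0r.
rewrite -mulr_sumr natrM mulrCA -mulrDr [X in (_ <= X)%R]mulrC ler_pM2l //.
by rewrite ltr0n; apply: leq_ltn_trans ls.
Qed.

(* A member [I :|: emb @: X], together with one set of size [m] through each
   [i < l - 1] outside [I], would have total deficit [l]. *)
Lemma dens_trace (I : {set 'I_n}) h : I \subset blk n 0 l -> h <= b ->
  #|I| + h + #|I :&: blk n 0 l.-1| <= m ->
  (dens (trace nN F I) h <= \sum_(i | i != last) (1 - dens (tr i) b))%R.
Proof.
move=> Il hb Ih; pose k := #|I :&: blk n 0 l.-1|.
have lS (i : 'I_l) : i != last -> i.+1 < l.
  by rewrite -val_eqE /=; have := ltn_ord i; lia.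
(* The blocks [H i.+1] avoid [H 0], which contains the [h]-set; they exist because [i.+1 < l < s]
   for [i != last]. *)
have bound (t : {perm 'I_N}) : (t @: blk N 0 h \in trace nN F I) <=
    \sum_(i < l) (i != last) * (t @: H i.+1 \notin tr i).
  case hI : (_ \in trace nN F I) => //=; rewrite lt0n sum_nat_eq0.
  apply/negP => /forall_inP allH.
  have inH i : i != last -> t @: H i.+1 \in tr i.
    by move=> il; have := allH i isT; rewrite il mul1n eqb0 negbK.
  (* The index [last] stands for the given member, whatever [I] is. That member has deficit at least
     [k + 1], and each of the other [l - k - 1] indices contributes a set of size [m], of deficit
     [1]. *)
  pose J := [set i | (i == last) || (el i \notin I)].
  have cJ : #|J| + k = l.
    rewrite -[RHS]card_ord -(cardsC J); congr (_ + _).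
    rewrite /k -(card_imset _ el_inj); apply: eq_card => y; rewrite !inE add0n.
    apply/andP/imsetP => [[yI yl]|[i + ->]].
      have yl' : y < l by lia.
      exists (Ordinal yl'); last exact: val_inj.
      have {}yl : y < l.-1 by case/andP: yl.
      rewrite !inE negb_or negbK -val_eqE /= neq_ltn yl /=.
      by rewrite (_ : el _ = y) //; apply: val_inj.
    rewrite !inE negb_or negbK => /andP[il ->]; split=> //=.
    by have := lS i il; lia.
  apply: (@light_traces J (fun i => if i == last then I else [set el i])
    (fun i => if i == last then t @: blk N 0 h else t @: H i.+1)).
  - by move=> i _; case: ifP.
  - move=> i j; rewrite !inE.
    case: (eqVneq i last) => [->|il]; case: (eqVneq j last) => [->|jl] //=.
    + by move=> _ jI _; rewrite disjoint_sym disjoints1.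
    + by move=> iI _ _; rewrite disjoints1.
    by move=> _ _ ij; rewrite disjoints1 inE; apply: contra ij => /eqP/el_inj->.
  - have dH i : [disjoint t @: blk N 0 h & t @: H i.+1].
      apply: disjoint_imset; first exact: perm_inj.
      by apply: disjoint_blk; rewrite mulSn; lia.
    move=> i j _ _ ij; case: ifP => il; case: ifP => jl //.
    + by rewrite (eqP il) (eqP jl) eqxx in ij.
    + by rewrite disjoint_sym.
    by apply: disjoint_H; rewrite eqSS; apply: contra ij => /eqP e; apply/eqP/val_inj.
  - by move=> i _; case: eqVneq => [_|il]; [exact: hI | exact: inH].
  rewrite (bigD1 last) /=; last by rewrite inE eqxx.
  rewrite eqxx card_imset ?card_blk; last exact: perm_inj; last first.
    by have := leq_pmull b (ltn_trans l_gt0 ls); lia.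
  rewrite (eq_bigr (fun _ => m)) => [|i /andP[_ il]]; last first.
    by rewrite (negbTE il) cards1 card_tH //; have := lS i il; lia.
  rewrite sum_nat_const (_ : #|_| = #|J|.-1); last first.
    have lJ : last \in J by rewrite inE eqxx.
    by rewrite (cardsD1 last J) lJ add1n /=; apply: eq_card => i; rewrite [RHS]in_setD1 andbC.
  have J0 : 0 < #|J| by apply/card_gt0P; exists last; rewrite inE eqxx.
  rewrite -{2}(prednK J0) [_.+1 * _]mulSn [_ * m.+1]mulnS; move: J0 cJ Ih; rewrite -/k.
  by move: #|J| #|I| => j x; lia.
have := ler_mean bound; rewrite mean_mem mean_sum card_blk; last first.
  by have := leq_pmull b (ltn_trans l_gt0 ls); lia.
rewrite [X in _ -> (_ <= X)%R]big_mkcond; congr (_ <= _)%R; apply: eq_bigr => i _.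
rewrite meanZ; case: eqVneq => [_|il]; first by rewrite mul0r.
rewrite mul1r mean_notin card_blk //.
apply: leq_trans (leq_mulS_lt b (_ : i.+1 < s)) sbN.
by have := lS i il; lia.
Qed.

Lemma dens_le_last (F' : {set {set 'I_N}}) h : h <= b ->
  (forall X Y : {set 'I_N}, X \in F' -> X \subset Y -> Y \in tr last) ->
  (dens F' h <= dens (tr last) b)%R.
Proof.
move=> hb F'P; have bN : b <= N.
  by apply: leq_trans sbN; apply: leq_pmull; apply: leq_ltn_trans ls.
have bound (t : {perm 'I_N}) : (t @: blk N 0 h \in F') <= (t @: blk N 0 b \in tr last).
  case hF : (_ \in F') => //=; rewrite lt0b; apply: (F'P _ _ hF); apply: imsetS.
  by apply/subsetP => x; rewrite !inE; lia.
by have := ler_mean bound; rewrite !mean_mem !card_blk //; lia.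
Qed.

Lemma dens0_last h : h <= b -> (dens tr0 h <= dens (tr last) b)%R.
Proof.
move=> hb; apply: dens_le_last => // X Y; rewrite !inE set0U => XF XY.
by apply: F_up XF _; apply: subset_trans (imsetS _ XY) (subsetUr _ _).
Qed.

Lemma dens_last h : h <= b -> (dens (tr last) h <= dens (tr last) b)%R.
Proof.
move=> hb; apply: dens_le_last => // X Y; rewrite !inE => XF XY.
by apply: F_up XF _; apply: setUS; apply: imsetS.
Qed.

(* By shifting, replacing a point by [l - 1] maps the shadow of [tr0] into
   [tr last]. *)
Lemma level_shadow : level tr0 m <= (l - 1) * level (tr last) b.
Proof.
pose G := [set X in tr0 | #|X| == m].
have GP X : X \in G -> emb nN @: X \in F /\ #|X| = m.
  by rewrite !inE set0U => /andP[-> /eqP].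
have G_shift : shifted G.
  move=> X i j XG ij jX iX; have [XF cX] := GP X XG; rewrite !inE set0U.
  rewrite card_imset ?cX ?eqxx ?andbT; last exact: perm_inj.
  have -> : emb nN @: (tperm i j @: X) =
            tperm (emb nN i) (emb nN j) @: (emb nN @: X).
    rewrite -!imset_comp; apply: eq_imset => x /=.
    by rewrite inj_tperm //; apply: (@emb_inj _ _ _ nN).
  by apply: F_shift; rewrite ?mem_imset //= ?ltn_add2l //; apply: (@emb_inj _ _ _ nN).
have G_matching : ~~ has_matching G (l - 1).+1.
  rewrite subn1 prednK //; apply/negP => /has_matchingP[Y [YG dY]].
  apply: (@light_traces setT (fun _ => set0) Y).
  - by move=> i _; apply: sub0set.
  - by move=> i j _ _ _; rewrite -setI_eq0 setI0.
  - by move=> i j _ _ /eqP ij; rewrite -setI_eq0 dY.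
  - by move=> i _; have := YG i; rewrite inE => /andP[].
  rewrite (eq_bigr (fun _ => m)) => [|i _].
    by rewrite sum_nat_const cardsT card_ord mulnS addnC.
  by rewrite cards0; have [_ ->] := GP _ (YG i).
have := shadow_bound G_shift (fun X XG => proj2 (GP X XG)) (ltn0Sn b) G_matching.
move=> le_sh; apply: leq_trans le_sh _; rewrite leq_mul2l; apply/orP; right.
apply/subset_leq_card/subsetP => B; rewrite inE => /exists_inP[A AG].
move=> /exists_inP[x xA /eqP ->]; have [AF cA] := GP A AG.
have lastA : el last \notin emb nN @: A.
  by apply/negP; apply: disjoint_false (disjoint_emb nN A (el_blk last)) _; rewrite inE.
have embD : emb nN @: A = emb nN x |: emb nN @: (A :\ x).
  by rewrite -imset_set1 -imsetU setD1K.
rewrite !inE; apply/andP; split; last first.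
  by have := cardsD1 x A; rewrite xA cA add1n => /eqP; rewrite eqSS eq_sym.
rewrite -(@tperm_setU1 _ _ (emb nN x)); first last.
- rewrite mem_imset; last exact: (@emb_inj _ _ _ nN).
  by rewrite !inE eqxx.
- by apply: contra lastA; apply/subsetP/imsetS/subD1set.
rewrite -embD; apply: F_shift => //=; first by rewrite prednK // leq_addr.
by rewrite mem_imset //; apply: (@emb_inj _ _ _ nN).
Qed.


Let P := [set A : {set 'I_n} | m.+1 <= #|A| + #|A :&: blk n 0 l.-1|].
(** [Delta] adds up, over [i < l - 1], the missing density of the [m]-sets that meet the first [l]
    points in [i] alone, all of which lie in [P]. [eta] is the member density of the [m]-sets that
    meet them in [l - 1] alone, none of which lies in [P]. Losses are bounded below by [Delta],
    gains above by [eta] and [Delta]. *)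
Let Delta : rat := (\sum_(i | i != last) (1 - dens (tr i) b))%R.
Let eta := dens (tr last) b.

Lemma setI_blk_el (i : 'I_l) (A : {set 'I_n}) : i != last ->
  A :&: blk n 0 l = [set el i] -> #|A :&: blk n 0 l.-1| = 1.
Proof.
move=> il Ai; rewrite (_ : A :&: blk n 0 l.-1 = [set el i]) ?cards1 //.
have sub : blk n 0 l.-1 \subset blk n 0 l.
  by apply/subsetP => x; rewrite !inE; lia.
rewrite -(setIidPr sub) setIA Ai; apply/setIidPl; rewrite sub1set inE /=.
by move: il; rewrite -val_eqE /=; have := ltn_ord i; lia.
Qed.

Lemma card_lost :
  (Delta * 'C(N, b)%:R <= #|[set A in P :\: F | (#|A| <= m)%N]|%:R)%R.
Proof.
set Lo := [set A in P :\: F | _].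
pose S i := [set A in ~: F | (A :&: blk n 0 l == [set el i]) &&
                              (#|A| == #|[set el i]| + b)].
have SE i : #|S i| + level (tr i) b = 'C(N, b).
  rewrite /S (card_trace nN _ _ (el_blk i)) -[N in 'C(N, _)]card_ord -cardsT.
  rewrite -cards_draws -[RHS](cardsID (tr i)) addnC; congr (_ + _).
    by apply: eq_card => X; rewrite !inE subsetT andbC.
  by apply: eq_card => X; rewrite !inE subsetT.
have dS i j : i != j -> [disjoint S i & S j].
  move=> ij; apply: disjoint_of => A; rewrite !inE => /and3P[_ /eqP-> _] /and3P[_].
  by rewrite (inj_eq set1_inj) (inj_eq el_inj) (negbTE ij).
have SLo i : i != last -> S i \subset Lo.
  move=> il; apply/subsetP => A; rewrite !inE => /and3P[AF /eqP Ai /eqP cA].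
  by rewrite AF (setI_blk_el il Ai) cA cards1 add1n addn1 !ltnSn.
have := leq_sum_cardI Lo dS; rewrite -(ler_nat rat); apply: le_trans.
rewrite natr_sum /Delta mulr_suml big_mkcond; apply: ler_sum => i _.
case: ifP => [il|_]; last exact: ler0n.
rewrite (setIidPl (SLo i il)) mulrBl mul1r -levelE; last first.
  by apply: leq_trans sbN; apply: leq_pmull; apply: leq_ltn_trans ls.
by rewrite -(SE i) natrD addrK.
Qed.

Let Ec (G : {set {set 'I_n}}) := [set A in G |
  (A :&: blk n 0 l.-1 != set0) && (#|A| + #|A :&: blk n 0 l.-1| <= m)].

Let Delta_ge0 : (0 <= Delta)%R.
Proof. by apply: sumr_ge0 => i _; rewrite subr_ge0 dens_le1. Qed.

(** The condition defining [Ec] depends only on the size of a set and its intersection with the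
    first [l] points. In each class with these data fixed, [dens_trace] bounds the share of members
    by [Delta]. *)
Lemma card_excess_class : (#|Ec F|%:R <= Delta * #|Ec setT|%:R)%R.
Proof.
pose p (A : {set 'I_n}) := (A :&: blk n 0 l, inord #|A| : 'I_n.+1).
have pE A A' : p A' = p A -> A' :&: blk n 0 l = A :&: blk n 0 l /\ #|A'| = #|A|.
  case=> -> /(congr1 val) /=; rewrite !inordK // ltnS -[leqRHS]card_ord max_card //.
have part (G : {set {set 'I_n}}) : #|Ec G| = \sum_q #|[set A in Ec G | p A == q]|.
  rewrite -sum1_card (partition_big p xpredT) //=; apply: eq_bigr => q _.
  by rewrite sum1dep_card; apply: eq_card => A; rewrite !inE.
rewrite !part !natr_sum mulr_sumr; apply: ler_sum => q _.
have [->|[A]] := set_0Vmem [set A in Ec F | p A == q].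
  by rewrite cards0 mulr_ge0 ?ler0n.
rewrite inE => /andP[AE /eqP <-] {q}; move: AE; rewrite inE => /andP[AF /andP[A0 Am]].
pose I := A :&: blk n 0 l; pose h := #|A| - #|I|.
have Il : I \subset blk n 0 l by apply: subsetIr.
have IA : #|I| <= #|A| by apply/subset_leq_card/subsetIl.
have sub : blk n 0 l.-1 \subset blk n 0 l.
  by apply/subsetP => x; rewrite !inE; lia.
have I1 : I :&: blk n 0 l.-1 = A :&: blk n 0 l.-1 by rewrite /I -setIA (setIidPr sub).
have I1_gt0 : 0 < #|I :&: blk n 0 l.-1| by rewrite I1 card_gt0.
have hb : h <= b by rewrite -I1 in Am; move: Am; rewrite /h /m; lia.
have Ih : #|I| + h + #|I :&: blk n 0 l.-1| <= m by rewrite subnKC // I1.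
have bN : b <= N.
  by apply: leq_trans sbN; apply: leq_pmull; apply: leq_ltn_trans ls.
have classE (G : {set {set 'I_n}}) : #|[set B in Ec G | p B == p A]| = level (trace nN G I) h.
  rewrite -(card_trace nN G h Il); apply: eq_card => B; rewrite !inE subnKC //.
  apply/andP/and3P => [[/andP[BG _] /eqP/pE[-> ->]]|[BG /eqP BI /eqP cB]].
    by rewrite BG !eqxx.
  have B1 : B :&: blk n 0 l.-1 = A :&: blk n 0 l.-1.
    by rewrite -I1 -BI -setIA (setIidPr sub).
  by rewrite BG B1 A0 cB Am /p BI cB eqxx.
have full : level (trace nN setT I) h = 'C(N, h).
  by apply: level_full => X _; rewrite !inE.
rewrite !classE full levelE; last by lia.
by rewrite ler_wpM2r ?ler0n // dens_trace.
Qed.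

(** A set in [Ec] contains one of the first [l - 1] points, so its defining inequality leaves it at
    most [m - 1 = b] points in all. *)
Lemma card_excess_all : #|Ec setT| <= (l - 1) * \sum_(h < b) 'C(n.-1, h).
Proof.
have sub : Ec setT \subset \bigcup_(i | i != last) \bigcup_(h : 'I_b)
    [set A : {set 'I_n} | (el i \in A) && (#|A| == h.+1)].
  apply/subsetP => A; rewrite inE in_setT /= => /andP[/set0Pn[x xAl] Am].
  move: (xAl); rewrite in_setI => /andP[xA xl].
  have A0 : 0 < #|A| by apply/card_gt0P; exists x.
  have Ab : #|A|.-1 < b.
    have : 0 < #|A :&: blk n 0 l.-1| by apply/card_gt0P; exists x.
    by move: A0 Am; rewrite /m; move: #|A| #|A :&: _| => u v; lia.
  have xl' : x < l by move: xl; rewrite mem_blk; lia.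
  apply/bigcupP; exists (Ordinal xl').
    by rewrite -val_eqE /=; move: xl; rewrite mem_blk; lia.
  apply/bigcupP; exists (Ordinal Ab) => //.
  rewrite inE /= prednK // eqxx andbT (_ : el _ = x) //; exact: val_inj.
apply: leq_trans (subset_leq_card sub) (leq_trans (leq_card_bigcup _ _) _).
apply: (@leq_trans (\sum_(i < l | i != last) \sum_(h < b) 'C(n.-1, h))).
  apply: leq_sum => i _; apply: leq_trans (leq_card_bigcup _ _) _.
  by apply: leq_sum => h _; rewrite card_star.
by rewrite sum_nat_const cardC1 card_ord subn1.
Qed.

(** Of the first [l] points, a member counted here contains none, only [l - 1], or one before
    [l - 1]. The first kind is bounded by [dens0_last] below size [m] and by [level_shadow] at size
    [m], the second by [dens_last], whence the factor [2]; the third kind is [Ec F]. *)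
Lemma card_excess :
  (#|[set A in F :\: P | (#|A| <= m)%N]|%:R <=
   eta * (2 * \sum_(h < b.+1) 'C(N, h) + (l - 1) * 'C(N, b))%N%:R +
   Delta * ((l - 1) * \sum_(h < b) 'C(n.-1, h))%N%:R)%R.
Proof.
pose T I h := [set A in F | (A :&: blk n 0 l == I) && (#|A| == #|I| + h)].
have sub : [set A in F :\: P | #|A| <= m] \subset
  (\bigcup_(h : 'I_m.+1) T set0 h :|: \bigcup_(h : 'I_b.+1) T [set el last] h) :|: Ec F.
  apply/subsetP => A; rewrite !in_setU inE => /andP[].
  rewrite inE => /andP[AP AF] Am.
  case: (eqVneq (A :&: blk n 0 l.-1) set0) => [A0|A0]; last first.
    by apply/orP; right; move: AP; rewrite !inE AF A0 -leqNgt.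
  apply/orP; left; apply/orP.
  have A_lt x : x \in A -> x < l -> x = el last.
    move=> xA xl; apply: val_inj => /=; apply/eqP; rewrite eqn_leq -ltnS prednK // xl.
    rewrite leqNgt; apply/negP => xl1; have : x \in A :&: blk n 0 l.-1.
      by rewrite in_setI xA mem_blk.
    by rewrite A0 inE.
  case lA: (el last \in A); [right | left].
    have Apos : 0 < #|A| by apply/card_gt0P; exists (el last).
    have hP : #|A|.-1 < b.+1 by rewrite prednK.
    apply/bigcupP; exists (Ordinal hP) => //; rewrite inE AF cards1 add1n prednK // eqxx andbT.
    apply/eqP/setP => x; rewrite in_setI in_set1 mem_blk add0n /=.
    apply/andP/eqP => [[]|->]; first exact: A_lt.
    by rewrite lA /= prednK.
  have hP : #|A| < m.+1 by rewrite ltnS.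
  apply/bigcupP; exists (Ordinal hP) => //; rewrite inE AF cards0 add0n eqxx andbT.
  apply/eqP/setP => x; rewrite in_setI in_set0 mem_blk add0n /=.
  by apply/negP => /andP[xA /(A_lt x xA) xl]; rewrite -xl xA in lA.
have TE0 h : #|T set0 h| = level tr0 h by rewrite /T (card_trace nN) // sub0set.
have TE1 h : #|T [set el last] h| = level (tr last) h by rewrite /T (card_trace nN).
have le_card : #|[set A in F :\: P | #|A| <= m]| <=
    \sum_(h < m) level tr0 h + (l - 1) * level (tr last) b +
    \sum_(h < b.+1) level (tr last) h + #|Ec F|.
  apply: leq_trans (subset_leq_card sub) (leq_trans (leq_card_setU _ _) _).
  rewrite leq_add2r; apply: leq_trans (leq_card_setU _ _) _; apply: leq_add.
    apply: leq_trans (leq_card_bigcup _ _) _; under eq_bigr do rewrite TE0.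
    by rewrite big_ord_recr /= leq_add2l level_shadow.
  by apply: leq_trans (leq_card_bigcup _ _) _; under eq_bigr do rewrite TE1.
have bN : b <= N.
  by apply: leq_trans sbN; apply: leq_pmull; apply: leq_ltn_trans ls.
have le0 : ((\sum_(h < m) level tr0 h)%:R <=
            eta * (\sum_(h < b.+1) 'C(N, h))%:R :> rat)%R.
  rewrite !natr_sum mulr_sumr; apply: ler_sum => h _; have hb : h <= b by rewrite -ltnS.
  by rewrite levelE ?ler_wpM2r ?ler0n ?dens0_last //; apply: leq_trans bN.
have le1 : ((\sum_(h < b.+1) level (tr last) h)%:R <=
            eta * (\sum_(h < b.+1) 'C(N, h))%:R :> rat)%R.
  rewrite !natr_sum mulr_sumr; apply: ler_sum => h _; have hb : h <= b by rewrite -ltnS.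
  by rewrite levelE ?ler_wpM2r ?ler0n ?dens_last //; apply: leq_trans bN.
have le2 : (#|Ec F|%:R <= Delta * ((l - 1) * \sum_(h < b) 'C(n.-1, h))%N%:R :> rat)%R.
  apply: le_trans card_excess_class _; rewrite ler_wpM2l // ler_nat.
  exact: card_excess_all.
have lastE : (((l - 1) * level (tr last) b)%N%:R = eta * ((l - 1) * 'C(N, b))%N%:R :> rat)%R.
  by rewrite !natrM levelE // -/eta mulrCA.
move: le_card; rewrite -(ler_nat rat) !natrD lastE => le_card.
apply: le_trans le_card _; rewrite natrM mulrDr.
by move: le0 le1 le2; lra.
Qed.

(** [mean_last] amounts to (s - l + 1) eta <= Delta. The binomials up to level [b] sum to at most 2
    C(N, b), so the [eta] part of the excess is at most (4 + l - 1) eta C(N, b) <= (4/7) Delta C(N,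
    b). The last hypothesis bounds the other part by (3/7) Delta C(N, b), and [card_lost] provides
    Delta C(N, b). *)
Lemma light_low :
  \sum_(h < b) 'C(N, h) <= 'C(N, b) ->
  7 * (l + 3) <= 4 * (s - l + 1) ->
  7 * ((l - 1) * \sum_(h < b) 'C(n.-1, h)) <= 3 * 'C(N, b) ->
  low F m <= low P m.
Proof.
move=> S_le l_le Q_le.
have eta_le : ((s - l + 1)%:R * eta <= Delta)%R.
  have := mean_last; rewrite -/eta /Delta sumrB.
  rewrite (_ : (\sum_(i < l | i != last) 1 = (l - 1)%:R :> rat)%R); first lra.
  by rewrite sumr_const cardC1 card_ord subn1.
have eta_ge0 : (0 <= eta)%R by apply: dens_ge0.
have le_EL : #|[set A in F :\: P | #|A| <= m]| <= #|[set A in P :\: F | #|A| <= m]|.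
  rewrite -(ler_nat rat); apply: le_trans card_excess (le_trans _ card_lost).
  have le1 : (eta * (2 * \sum_(h < b.+1) 'C(N, h) + (l - 1) * 'C(N, b))%N%:R <=
              eta * ((l + 3) * 'C(N, b))%N%:R)%R.
    rewrite ler_wpM2l // ler_nat big_ord_recr /=.
    have -> : (l + 3) * 'C(N, b) = 4 * 'C(N, b) + (l - 1) * 'C(N, b).
      by rewrite -mulnDl; congr (_ * _); lia.
    by rewrite leq_add2r; move: (\sum_(h < b) _) 'C(N, b) S_le => u v; lia.
  apply: le_trans (lerD le1 (lexx _)) _.
  have le2 : (7 * (eta * (l + 3)%:R) <= 4 * Delta)%R.
    have : ((7 * (l + 3))%N%:R * eta <= (4 * (s - l + 1))%N%:R * eta)%R.
      by rewrite ler_wpM2r // ler_nat.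
    by rewrite !natrM; move: eta_le; lra.
  have le3 : (7 * ((l - 1) * \sum_(h < b) 'C(n.-1, h))%N%:R <= 3 * 'C(N, b)%:R :> rat)%R.
    by rewrite -!natrM ler_nat.
  have := ler_wpM2l Delta_ge0 le3; have := ler_wpM2r (ler0n rat 'C(N, b)) le2.
  rewrite [(((l + 3) * _)%N%:R)%R]natrM.
  by lra.
rewrite !lowE -(cardsID P [set A in F | _]) -(cardsID F [set A in P | _]).
apply: leq_add.
  by apply/subset_leq_card/subsetP => A; rewrite !inE => /andP[/andP[-> ->] ->].
move: le_EL; congr (_ <= _); apply: eq_card => A; rewrite !inE.
  by rewrite andbA.
by rewrite andbA.
Qed.

End Light.

(** [heavy] is a [Prop] quantifying over functions; with finite functions in their place it becomes
    a boolean. *)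
Lemma heavy_dec n (F : {set {set 'I_n}}) m l : heavy F m l \/ ~ heavy F m l.
Proof.
pose P := [exists J : {set 'I_l}, [exists D : {ffun 'I_l -> {set 'I_n}},
  [&& [forall j in J, D j \in F],
      [forall i in J, [forall j in J, (i != j) ==> [disjoint D i & D j]]]
    & \sum_(j in J) #|D j| + l <= #|J| * m.+1]]].
case hP : P; [left | right].
  have /existsP[J /existsP[D /and3P[/forall_inP DF /forall_inP dD sumD]]] := hP.
  exists J, D; split=> // i j iJ jJ ij.
  by have /forall_inP/(_ j jJ)/implyP := dD i iJ; apply.
move=> [J [D [DF dD sumD]]]; move/negbT/negP: hP; apply; rewrite /P.
apply/existsP; exists J; apply/existsP; exists (finfun D); apply/and3P; split.
- by apply/forall_inP => j jJ; rewrite ffunE DF.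
- apply/forall_inP => i iJ; apply/forall_inP => j jJ; apply/implyP => ij.
  by rewrite !ffunE dD.
by under eq_bigr do rewrite ffunE.
Qed.

Lemma bin_budget_light s b l (n := s * b.+1 + s - l) (N := n - l) :
  0 < l -> l * b.+1 + 3 * l + 3 <= s ->
  [/\ n = l + N, s * b <= N, \sum_(h < b) 'C(N, h) <= 'C(N, b),
      7 * (l + 3) <= 4 * (s - l + 1)
    & 7 * ((l - 1) * \sum_(h < b) 'C(n.-1, h)) <= 3 * 'C(N, b)].
Proof.
move=> l0 sl.
have [c lE] : exists c, l = c + 1 by exists (l - 1); lia.
have [t sE] : exists t, s = 7 + b + 4 * c + t + b * c.
  exists (s - (l * b.+1 + 3 * l + 3)); move: sl.
  have -> : l * b.+1 + 3 * l + 3 = 7 + b + 4 * c + b * c by rewrite lE -addn1; ring.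
  by lia.
have nE : n = 13 + 9 * b + 7 * c + 2 * t + b ^ 2 + 6 * b * c + b * t + b ^ 2 * c.
  rewrite /n (_ : s * b.+1 + s = 13 + 9 * b + 7 * c + 2 * t + b ^ 2 + 6 * b * c +
    b * t + b ^ 2 * c + l) ?addnK //.
  by rewrite sE lE -[b.+1]addn1; ring.
have NE : N = 12 + 9 * b + 6 * c + 2 * t + b ^ 2 + 6 * b * c + b * t + b ^ 2 * c.
  by rewrite /N nE lE; move: (b ^ 2) (b * c) (b * t) (b ^ 2 * c) => ? ? ? ?; lia.
have nN : n = l + N.
  by rewrite nE NE lE; move: (b ^ 2) (b * c) (b * t) (b ^ 2 * c) => ? ? ? ?; lia.
split=> //.
- by rewrite NE sE; apply: leq_trans (leq_addr (12 + 2 * b + 6 * c + 2 * t + 2 * b * c) _) _;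
    apply: eq_leq; ring.
- have [b0|b0] := posnP b; first by rewrite b0 big_ord0.
  rewrite -(leq_pmul2l b0); apply: leq_trans (sum_bin_lt (n := N) (m := b) _).
    rewrite leq_mul2r; apply/orP; right; rewrite NE.
    by move: (b ^ 2) (b * c) (b * t) (b ^ 2 * c) => ? ? ? ?; lia.
  by rewrite NE; move: (b ^ 2) (b * c) (b * t) (b ^ 2 * c) => ? ? ? ?; lia.
- by rewrite sE lE; move: (b * c) => ?; lia.
have [b0|b0] := posnP b; first by rewrite b0 big_ord0 !muln0.
set Q := \sum_(h < b) _; set X := 'C(n.-1, b); set C := 'C(N, b).
have n1E : n.-1 = N + c by rewrite nN lE; lia.
(* [v] is [n - 2 * b], the factor of [sum_bin_lt] at [n.-1]; [u] is [n.-1 - b * c], the factor left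
   by [bin_diff] when C(n - 1, b) is compared with C(N, b). *)
pose v := 13 + 7 * b + 7 * c + 2 * t + b ^ 2 + 6 * b * c + b * t + b ^ 2 * c.
pose u := 12 + 9 * b + 7 * c + 2 * t + b ^ 2 + 5 * b * c + b * t + b ^ 2 * c.
have vQ : v * Q <= b * X.
  apply: leq_trans (sum_bin_lt (n := n.-1) (m := b) _).
    rewrite leq_mul2r; apply/orP; right; rewrite /v nE.
    by move: (b ^ 2) (b * c) (b * t) (b ^ 2 * c) => ? ? ? ?; lia.
  by rewrite nE; move: (b ^ 2) (b * c) (b * t) (b ^ 2 * c) => ? ? ? ?; lia.
have uX : u * X <= n.-1 * C.
  have := bin_diff N c b0; rewrite -n1E -/X -/C => /(leq_mul (leqnn n.-1)).
  rewrite mulnDr mulnCA mul_bin_pred // -/X.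
  have -> : n.-1 = u + b * c.
    by rewrite /u nE; move: (b ^ 2) (b * t) (b ^ 2 * c) => ? ? ?; lia.
  rewrite mulnDl (mulnA c b X) (mulnC c b).
  by rewrite leq_add2r.
have v0 : 0 < v by rewrite /v -!addnA.
have u0 : 0 < u by rewrite /u -!addnA.
rewrite -(@leq_pmul2l (v * u)); last by rewrite muln_gt0 v0.
have -> : v * u * (7 * ((l - 1) * Q)) = 7 * (l - 1) * u * (v * Q) by ring.
apply: leq_trans (_ : 7 * (l - 1) * u * (b * X) <= _).
  by rewrite leq_mul2l vQ orbT.
have -> : 7 * (l - 1) * u * (b * X) = 7 * (l - 1) * b * (u * X) by ring.
apply: leq_trans (_ : 7 * (l - 1) * b * (n.-1 * C) <= _).
  by rewrite leq_mul2l uX orbT.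
rewrite n1E NE lE addnK /u /v.
apply: leq_trans (leq_addr (C * (468 + 603 * b + 525 * c + 150 * t
   + 264 * b ^ 2 + 663 * b * c
      + 171 * b * t + 147 * c ^ 2 + 84 * c * t + 12 * t ^ 2 + 48 * b ^ 3
      + 321 * b ^ 2 * c + 60 * b ^ 2 * t + 182 * b * c ^ 2 + 94 * b * c * t
      + 12 * b * t ^ 2 + 3 * b ^ 4 + 74 * b ^ 3 * c + 6 * b ^ 3 * t
      + 90 * b ^ 2 * c ^ 2 + 38 * b ^ 2 * c * t + 3 * b ^ 2 * t ^ 2
      + 6 * b ^ 4 * c + 26 * b ^ 3 * c ^ 2 + 6 * b ^ 3 * c * t
      + 3 * b ^ 4 * c ^ 2)) _) _.
by apply: eq_leq; ring.
Qed.

Lemma e_calP_large s m l : 0 < m -> 0 < l -> l * m + 3 * l + 3 <= s ->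
  e (s * m + s - l) s = #|calP s m l|.
Proof.
case: m => // b _ l0 sl.
have ls : 0 < l <= s by rewrite l0; lia.
apply: (e_eq (calP_matching b.+1 ls)) => F Fs.
have [G [Gs FG G_shift G_up]] := exists_shifted Fs; apply: leq_trans FG _.
have [hG|lG] := heavy_dec G b.+1 l.
  exact: (card_le_heavy (erefl _) l0 (ltn0Sn b) sl Gs hG (@calP_big s b.+1 l)).
have [nN sbN S_le l_le Q_le] := bin_budget_light l0 sl.
have ls' : l < s by lia.
apply: (@card_le_low _ _ _ b.+1); first exact: calP_big.
apply: leq_trans (light_low nN l0 ls' sbN G_shift G_up lG S_le l_le Q_le) _.
rewrite !lowE; apply/subset_leq_card/subsetP => A; rewrite !inE => /andP[+ ->].
rewrite andbT addn1 (_ : blk _ 0 l.-1 = segment _ (l - 1)) //.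
by apply/setP => x; rewrite !inE add0n subn1.
Qed.

Theorem theorem1 (s m l n : nat) (hs : 2 <= s) (hm : 1 <= m)
    (hl : 1 <= l <= s) (hn : n = s * m + s - l) :
  [/\ (l = 2 /\ 5 <= s) \/ (l = 2 /\ s = 4 /\ ~~ odd m) ->
        e n s = #|calP s m l|,
      m = 1 -> e n s = #|calP s m l|
    & l * m + 3 * l + 3 <= s -> e n s = #|calP s m l|].
Proof.
subst n; split.
- by case=> [[-> s5]|[-> s4]]; apply: e_calP_l2 => //; [left | right].
- by move=> m1; move: hl; rewrite m1 => ls; apply: e_calP_m1.
by move=> sl; apply: e_calP_large => //; case/andP: hl.
Qed.
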